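(* Consider the decentralized multi-armed bandit with $N$ independent arms and $M<N$ players under the exogenous restless reward model (see context), under either of the two conflict models (players in conflict share the reward, or no player in conflict gets reward). Assume that all arms, when engaged, are modeled as finite-state, irreducible, aperiodic and reversible Markov chains, that all states (rewards) are positive, and that different arms have different stationary mean rewards. Let $f(t)$ be any increasing sequence with $f(t)\to\infty$ as $t\to\infty$. If the decentralized RUCB policy $\Phi$ (see context) is run with time-dependent parameters $L(t)$ and $D(t)$ chosen such that, as $t\to\infty$, $$L(t)\to\infty,\qquad \frac{f(t)}{D(t)}\to\infty,\qquad \frac{D(t)}{L(t)}\to\infty,$$ then the regret satisfies $$r_\Phi(t)= o\big(f(t)\log t\big)\qquad (t\to\infty).$$
   Context: **Model.** There are $M$ players and $N$ independent arms, $M<N$. Time is slotted, $t=1,2,\dots$. Arm $j$ has finite state space $\mathcal S_j$ (a set of real numbers; the state is the reward) and state $s_j(t)\in\mathcal S_j$ at time $t$. In each slot every player chooses one arm to play. When arm $j$ is played (engaged) its state changes according to the Markov transition matrix $P_j$. In the *exogenous restless model*, an arm that is played by no player in a slot keeps its state unchanged. Players do not know the matrices $P_j$, do not communicate, and decide on the basis of local observations only; a player playing an arm observes the current state of that arm. Let $\{\pi^j_s\}_{s\in\mathcal S_j}$ be the stationary distribution of $P_j$, $\mu_j=\sum_{s\in\mathcal S_j}s\,\pi^j_s$ the stationary mean reward, and $\sigma$ a permutation of $\{1,\dots,N\}$ with $\mu_{\sigma(1)}\ge\mu_{\sigma(2)}\ge\cdots\ge\mu_{\sigma(N)}$. **Reward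 and regret.** Let $T_j(t)$ be the number of slots up to time $t$ in which arm $j$ is played, and $t_j(n)$ the time of the $n$-th play of arm $j$. A conflict occurs when several players choose the same arm in the same slot. If players in conflict share the reward, the total reward by time $t$ is $R(t)=\sum_{j=1}^{N}\sum_{n=1}^{T_j(t)}s_j(t_j(n))$. If no player in conflict gets reward, $R(t)=\sum_{j=1}^{N}\sum_{n=1}^{T_j(t)}s_j(t_j(n))\,\mathbb I_j(t_j(n))$, where $\mathbb I_j(t_j(n))=1$ if arm $j$ is played by exactly one player at time $t_j(n)$ and $0$ otherwise. The regret of a policy $\Phi$ is $r_\Phi(t)=t\sum_{i=1}^{M}\mu_{\sigma(i)}-\mathbb E_\Phi[R(t)]$ (up to an additive $O(1)$ term, which does not affect growth rates). **Decentralized RUCB policy** (time-dependent positive parameters $L(t),D(t)$). For positive integers $k,l$ write $k\oslash l=((k-1)\bmod l)+1\in\{1,\dots,l\}$. Time is divided into consecutive exploration epochs and exploitation epochs, with the same schedule for all players $k=1,\dots,M$. Let $n_O(t)$ and $n_I(t)$ be the numbers of exploration and exploitation epochs completed before time $t$. 1. At $t=1$ the first exploration epoch starts, in which each player plays every arm once; thus $n_O(N+1)=1$, $n_I(N+1)=0$. 2. At the start $t$ of each subsequent epoch, let $X_1(t)=(4^{n_O(t)}-1)/3$ (the time each player has spent on each arm in exploration epochs). If $X_1(t)>D(t)\ln t$, the new epoch is an exploitation epoch; otherwise it is an exploration epoch. 3. The $n$-th exploitation epoch, starting at time $t$: each player computes for every arm $i$ the index $d_{i,t}=\bar s_i(t)+\sqrt{L(t)\ln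 t/T_i(t)}$, where here $\bar s_i(t)$ is the sample mean of all that player's observations of arm $i$ so far (in both types of epochs) and $T_i(t)$ is the number of times that player has played arm $i$ so far. Let $a^*_{(1)},\dots,a^*_{(M)}$ be the arms with the $M$ highest indexes, in decreasing order of index (computed separately by each player). The epoch consists of $M$ subepochs of length $2\times4^{n-1}$; in the $m$-th subepoch player $k$ plays its arm $a^*_{((m-k+M+1)\oslash M)}$. Then go to 2. 4. The $n$-th exploration epoch: it consists of $N$ subepochs of length $4^{n-1}$; in the $m$-th subepoch player $k$ plays arm $(m-k+N+1)\oslash N$. Then go to 2. *)

(* Defs.v *)
From HB Require Import structures.
From mathcomp Require Import all_boot all_order all_algebra all_fingroup finmap.
From mathcomp Require Import all_classical all_reals all_analysis.

Set Implicit Arguments.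
Unset Strict Implicit.
Unset Printing Implicit Defensive.
Import Order.TTheory GRing.Theory Num.Theory.
Import numFieldNormedType.Exports.

Local Open Scope classical_set_scope.
Local Open Scope ring_scope.

(* Conventions: slots are t = 1, 2, ... (slot 0 is never used), while players,
   arms and subepochs are numbered from 0. *)

Section MarkovChains.
Variables (R : realType) (S : finType).
Implicit Types (P : S -> S -> R) (pi : S -> R).

Definition stochastic P :=
  (forall x y, 0 <= P x y) /\ (forall x, \sum_y P x y = 1).

Fixpoint nstep P (n : nat) (x y : S) : R :=
  if n is n'.+1 then \sum_z P x z * nstep P n' z y else (x == y)%:R.

Definition irreducible_chain P :=
  forall x y, exists n, 0 < nstep P n x y.

(* For every x the gcd of {n > 0 | P^n(x, x) > 0} is 1. *)
Definition aperiodic_chain P :=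
  forall x (d : nat),
    (forall n, (0 < n)%N -> 0 < nstep P n x x -> (d %| n)%N) -> d = 1%N.

Definition stationary_distribution P pi :=
  [/\ forall x, 0 <= pi x,
      \sum_x pi x = 1
    & forall y, \sum_x pi x * P x y = pi y].

Definition reversible_chain P pi :=
  forall x y, pi x * P x y = pi y * P y x.

End MarkovChains.

Definition stationary_mean (R : realType) (S : {fset R}) (pi : S -> R) : R :=
  \sum_(x : S) val x * pi x.

(* A player's local history is the chronological list of the pairs
   (arm played, state observed); a decentralized policy maps a player and the
   local history of this player to the next arm to play. *)
Definition history (R : realType) (N : nat) := seq ('I_N * R).
Definition policy (R : realType) (M N : nat) := 'I_M -> history R N -> 'I_N.

Section Plays.
Variables (R : realType) (M N : nat) (Phi : policy R M N).
Variable x : 'I_N -> nat -> R. (* x j t is the state of arm j in slot t *)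

Fixpoint local_history (k : 'I_M) (n : nat) : history R N :=
  if n is n'.+1 then
    let h := local_history k n' in
    let i := Phi k h in rcons h (i, x i n)
  else [::].

Definition arm_of (k : 'I_M) (t : nat) : 'I_N :=
  Phi k (local_history k t.-1).

Definition engaged (j : 'I_N) (t : nat) : bool := [exists k, arm_of k t == j].

Definition unshared (j : 'I_N) (t : nat) : bool :=
  #|[set k : 'I_M | arm_of k t == j]%SET| == 1%N.

(* The list t_j(1), ..., t_j(T_j(t)) of the slots up to t where arm j is
   played. *)
Definition play_times (j : 'I_N) (t : nat) : seq nat :=
  [seq u <- iota 1 t | engaged j u].

End Plays.

(* [Sharing]: players in conflict share the reward of the arm;
   [Collision]: no player in conflict gets reward. *)
Inductive conflict_model := Sharing | Collision.

Definition total_reward (R : realType) (M N : nat) (c : conflict_model)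
    (Phi : policy R M N) (x : 'I_N -> nat -> R) (t : nat) : R :=
  match c with
  | Sharing =>
      \sum_(j < N) \sum_(u <- play_times Phi x j t) x j u
  | Collision =>
      \sum_(j < N) \sum_(u <- play_times Phi x j t)
        x j u * (unshared Phi x j u)%:R
  end.

(* The states of the arms under the policy [Phi] in the exogenous restless
   model.  Since [Phi] is deterministic, the arms played in slots 1, ..., t
   are functions of the states in slots 1, ..., t; given these states, each
   arm moves independently of the others, according to its transition matrix
   if some player plays it in slot t, and not at all otherwise.  The initial
   states are independent, with arbitrary laws. *)
Record exogenous_process (R : realType) (M N : nat) (S : 'I_N -> {fset R})
    (P : forall j, S j -> S j -> R) (Phi : policy R M N)
    (d : measure_display) (Omega : measurableType d)
    (Pr : probability Omega R) (s : forall j, nat -> Omega -> S j) : Prop := {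
  process_measurable : forall (j : 'I_N) (t : nat) (y : S j),
    measurable [set w | s j t w = y];
  process_initial : forall x : forall j, S j,
    Pr [set w | forall j, s j 1%N w = x j]
    = (\prod_(j < N) fine (Pr [set w | s j 1%N w = x j]))%:E;
  process_step : forall (t : nat) (x : forall j, nat -> S j), (0 < t)%N ->
    Pr [set w | forall j u, (1 <= u <= t.+1)%N -> s j u w = x j u]
    = (Pr [set w | forall j u, (1 <= u <= t)%N -> s j u w = x j u]
       * (\prod_(j < N)
            if engaged Phi (fun i u => val (x i u)) j t
            then P j (x j t) (x j t.+1)
            else (x j t.+1 == x j t)%:R)%:E)%E
}.

Definition ranks_means (R : realType) (N : nat) (mu : 'I_N -> R)
    (sigma : 'S_N) :=
  forall i j : 'I_N, (i <= j)%N -> mu (sigma j) <= mu (sigma i).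

Definition regret (R : realType) (M N : nat) (c : conflict_model)
    (mu : 'I_N -> R) (sigma : 'S_N) (Phi : policy R M N)
    (d : measure_display) (Omega : measurableType d)
    (Pr : probability Omega R) (s : 'I_N -> nat -> Omega -> R) (t : nat) : R :=
  t%:R * (\sum_(i < N | (i < M)%N) mu (sigma i))
  - fine ('E_Pr[fun w => total_reward c Phi (fun j u => s j u w) t]).

Section RUCB.
Variables (R : realType) (M N : nat) (hMN : (M < N)%N).
Variables L D : nat -> R.

(* An epoch starts at slot [ep_start], after [ep_nO] exploration and [ep_nI]
   exploitation epochs have been completed. *)
Record epoch := Epoch {
  ep_start : nat;
  ep_nO : nat;
  ep_nI : nat;
  ep_exploit : bool }.

Definition subepoch_length (e : epoch) : nat :=
  if ep_exploit e then (2 * 4 ^ ep_nI e)%N else (4 ^ ep_nO e)%N.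

Definition epoch_end (e : epoch) : nat :=
  (ep_start e + (if ep_exploit e then M else N) * subepoch_length e)%N.

Definition exploitation_test (t nO : nat) : bool :=
  D t * ln t%:R < (4 ^+ nO - 1) / 3.

Definition first_epoch : epoch := Epoch 1 0 0 false.

Definition next_epoch (e : epoch) : epoch :=
  let t := epoch_end e in
  let nO := (ep_nO e + ~~ ep_exploit e)%N in
  let nI := (ep_nI e + ep_exploit e)%N in
  Epoch t nO nI (exploitation_test t nO).

(* [epoch_after n] is the epoch containing slot n.+1. *)
Fixpoint epoch_after (n : nat) : epoch :=
  if n is n'.+1 then
    let e := epoch_after n' in
    if (n.+1 < epoch_end e)%N then e else next_epoch e
  else first_epoch.

Definition play_count (h : history R N) (i : 'I_N) : nat :=
  count (fun o => o.1 == i) h.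

Definition sample_mean (h : history R N) (i : 'I_N) : R :=
  (\sum_(o <- h | o.1 == i) o.2) / (play_count h i)%:R.

(* The index of arm i at the slot t following the local history h. *)
Definition ucb_index (h : history R N) (i : 'I_N) : R :=
  let t := (size h).+1 in
  sample_mean h i + Num.sqrt (L t * ln t%:R / (play_count h i)%:R).

(* a lists the M arms with the highest values of ind, in decreasing order;
   ties may be broken in any way. *)
Definition top_arms (ind : 'I_N -> R) (a : 'I_M -> 'I_N) :=
  [/\ injective a,
      forall m m' : 'I_M, (m <= m')%N -> ind (a m') <= ind (a m)
    & forall i, (forall m, a m <> i) -> forall m, ind i <= ind (a m)].

(* The 0-based form of the 1-based rule ((m - k + n) mod n) + 1; the natural
   subtraction is not truncated, since only k < n occurs. *)
Definition cyclic_shift (n : nat) (hn : (0 < n)%N) (m k : nat) : 'I_n :=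
  Ordinal (ltn_pmod (m + n - k) hn).

(* best k h lists the M arms selected by player k at the start of an
   exploitation epoch, when its local history is h. *)
Definition rucb (best : 'I_M -> history R N -> 'I_M -> 'I_N) : policy R M N :=
  fun k h =>
    let e := epoch_after (size h) in
    let m := (((size h).+1 - ep_start e) %/ subepoch_length e)%N in
    if ep_exploit e then
      best k (take (ep_start e).-1 h)
        (cyclic_shift (leq_ltn_trans (leq0n k) (ltn_ord k)) m k)
    else cyclic_shift (leq_ltn_trans (leq0n M) hMN) m k.

Definition rucb_policy (Phi : policy R M N) : Prop :=
  exists best : 'I_M -> history R N -> 'I_M -> 'I_N,
    (forall k h, top_arms (ucb_index h) (best k h)) /\
    (forall k h, Phi k h = rucb best k h).

End RUCB.

(* Main.v *)
(* Let [g] solve the Poisson equation [g - P g = phi] of an arm, where [phi] is the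
   deviation of the state from the stationary mean.  Since the state of an arm that is
   not played is frozen, the sum of [phi] over the slots in which it is played, plus
   [g] of the current state, is a martingale; hence the expected reward is
   [sum_j mu_j E(T_j) + O(1)], and the regret is bounded, up to [O(1)], by a constant
   times the expected number of bad slots: those in which the [M] best arms are not
   played by exactly one player each.

   Slots of exploration epochs number [O(D log t) = o(f log t)] by the rule that starts
   these epochs.  In an exploitation epoch starting at [tau], bad slots require that
   some sample mean be off by a fixed [eps], although it rests on more than
   [D(tau) log tau] observations (the padding term of the index vanishes because
   [D / L] diverges).  A player observes an arm during [O(log tau)] runs of slots, so
   an exponential supermartingale built from the same [g], losing [O(1)] per run,
   bounds the probability of this event by [O(1 / tau)] once [D(tau)] is large.  An
   epoch starting at [tau] ends before a fixed multiple of [tau], so the expected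
   number of bad exploitation slots up to [t] is [O(log t)]. *)
Require Import Defs.
From HB Require Import structures.
From mathcomp Require Import all_boot all_order all_algebra all_fingroup finmap.
From mathcomp Require Import all_classical all_reals all_analysis.
From mathcomp Require Import ring lra zify.
Set Implicit Arguments.
Unset Strict Implicit.
Unset Printing Implicit Defensive.
Import Order.TTheory GRing.Theory Num.Theory.
Import numFieldNormedType.Exports.
Local Open Scope classical_set_scope.
Local Open Scope ring_scope.

(** * Poisson equation and exponential tilting for a single finite chain *)

Section PoissonEquation.
Variables (R : realType) (S : finType) (P : S -> S -> R) (pi : S -> R).
Hypotheses (hP : stochastic P) (hirr : irreducible_chain P).
Hypothesis hpi : stationary_distribution P pi.

Lemma nstep_invariant (nu : S -> R) n :
  (forall y, \sum_x nu x * P x y = nu y) ->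
  forall y, \sum_x nu x * nstep P n x y = nu y.
Proof.
move=> hnu; elim: n => [|n IHn] y /=.
  rewrite (bigD1 y)//= eqxx mulr1 big1 ?addr0// => x /negPf ->.
  by rewrite mulr0.
under eq_bigr do rewrite mulr_sumr.
rewrite exchange_big /= -[RHS]IHn; apply: eq_bigr => z _.
by rewrite -hnu mulr_suml; apply: eq_bigr => x _; rewrite mulrA.
Qed.

Lemma nstep_ge0 n x y : 0 <= nstep P n x y.
Proof.
elim: n x => [|n IHn] x /=; first by rewrite ler0n.
by apply: sumr_ge0 => z _; apply: mulr_ge0 => //; case: hP.
Qed.

(** Invariance writes [nu y] as a sum of nonnegative terms [nu x * nstep P n x y]; irreducibility
    supplies for each [x] an [n] with a positive second factor. *)
Lemma invariant_vanishes (nu : S -> R) (y : S) :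
  (forall x, 0 <= nu x) -> (forall y, \sum_x nu x * P x y = nu y) ->
  nu y = 0 -> forall x, nu x = 0.
Proof.
move=> nu0 hnu nuy x; have [n hn] := hirr x y.
have /eqP := nstep_invariant n hnu y.
rewrite nuy psumr_eq0 => [/allP/(_ x)|z _]; last first.
  by rewrite mulr_ge0 ?nstep_ge0.
rewrite mem_index_enum => /(_ isT)/implyP/(_ isT).
by rewrite mulf_eq0 (gt_eqF hn) orbF => /eqP.
Qed.

Lemma stationary_gt0 x : 0 < pi x.
Proof.
have [pi0 pi1 hinv] := hpi; rewrite lt_neqAle pi0 andbT eq_sym.
apply/eqP => pix; have pi_eq0 := invariant_vanishes pi0 hinv pix.
by move: pi1; rewrite big1 => [/eqP|//]; rewrite eq_sym oner_eq0.
Qed.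

(** Subtract from [nu] the largest multiple of [pi] that leaves a nonnegative measure. The
    difference is invariant and vanishes where [nu / pi] is minimal, hence everywhere. *)
Lemma invariant_proportional (nu : S -> R) :
  (forall y, \sum_x nu x * P x y = nu y) ->
  exists c, forall x, nu x = c * pi x.
Proof.
move=> hnu; have [pi0 pi1 hinv] := hpi.
have [x0 _] : exists x0 : S, true.
  apply/existsP; apply: contraT => /existsPn h.
  by move: pi1; rewrite big1 => [/eqP|x]; [rewrite eq_sym oner_eq0|have := h x].
pose x1 := [arg min_(x < x0) (nu x / pi x)]%O.
have hmin x : nu x1 / pi x1 <= nu x / pi x.
  by rewrite /x1; case: arg_minP => // i _; apply.
set c := nu x1 / pi x1 in hmin; exists c => x.
apply/eqP; rewrite -subr_eq0; apply/eqP.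
apply: (@invariant_vanishes (fun x => nu x - c * pi x) x1).
- by move=> y; rewrite subr_ge0 -ler_pdivlMr ?stationary_gt0.
- move=> y; under eq_bigr do rewrite mulrBl -mulrA.
  by rewrite sumrB hnu -mulr_sumr hinv.
- by rewrite /c divfK ?subrr// gt_eqF ?stationary_gt0.
Qed.

(* By duality [(I - P) g = phi] is solvable if and only if [phi] is orthogonal
   to every left null vector of [I - P], i.e. to the multiples of [pi]. *)
Lemma poisson_solution (phi : S -> R) :
  \sum_x pi x * phi x = 0 ->
  exists (g : S -> R) (G : R), [/\ 0 <= G, forall x, 0 <= g x <= G
    & forall x, \sum_y P x y * g y = g x - phi x].
Proof.
move=> hphi; have [_ hP1] := hP.
pose n := #|S|.
pose A : 'M[R]_n := \matrix_(i, j) ((i == j)%:R - P (enum_val i) (enum_val j)).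
pose v : 'rV[R]_n := \row_i phi (enum_val i).
have enumS (F : S -> R) : \sum_(i < n) F (enum_val i) = \sum_x F x.
  rewrite [LHS](reindex enum_rank); last exact/onW_bij/enum_rank_bij.
  by apply: eq_bigr => x _; rewrite enum_rankK.
(* [v] lies in the row space of [A^T] exactly when it annihilates the cokernel, whose columns are
   invariant signed measures of [P]. *)
have /submxP[g0 hg0] : (v <= A^T)%MS.
  rewrite submxE; apply/eqP.
  have := mulmx_coker A^T; move: (cokermx _) => C hC.
  apply/matrixP => i j; rewrite !mxE.
  have [|c hc] := @invariant_proportional (fun x => C (enum_rank x) j).
    move=> y; have /matrixP/(_ (enum_rank y) j) := hC.
    rewrite !mxE => /eqP.
    under eq_bigr do rewrite !mxE mulrBl.
    rewrite sumrB subr_eq0 => /eqP.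
    rewrite (bigD1 (enum_rank y))//= eqxx mul1r big1 => [|k /negPf ->].
      rewrite addr0 => ->; rewrite -enumS; apply: eq_bigr => k _.
      by rewrite enum_valK enum_rankK mulrC.
    by rewrite mul0r.
  transitivity (\sum_(k < n) c * (pi (enum_val k) * phi (enum_val k))).
    apply: eq_bigr => k _; rewrite !mxE -[k in C k]enum_valK hc.
    by rewrite mulrC mulrA.
  by rewrite -mulr_sumr (enumS (fun x => pi x * phi x)) hphi mulr0.
pose g1 x := g0 0 (enum_rank x).
have hg1 x : \sum_y P x y * g1 y = g1 x - phi x.
  have /matrixP/(_ 0 (enum_rank x)) := hg0.
  rewrite !mxE enum_rankK.
  under eq_bigr do rewrite !mxE mulrBr.
  rewrite sumrB (bigD1 (enum_rank x))//= eqxx mulr1 big1 ?addr0; last first.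
    by move=> k /negPf; rewrite eq_sym => ->; rewrite mulr0.
  rewrite enum_rankK => ->; rewrite opprB addrC subrK -enumS.
  by apply: eq_bigr => k _; rewrite /g1 enum_valK mulrC.
(* Solutions may be shifted by constants, since the rows of [P] sum to 1; the shift by [B] places
   the values in the interval from 0 to [2B]. *)
pose B := \sum_x `|g1 x|.
have hB x : `|g1 x| <= B.
  by rewrite /B (bigD1 x)//= lerDl sumr_ge0.
exists (fun x => g1 x + B), (B + B); split.
- by rewrite addr_ge0// sumr_ge0.
- by move=> x; have := hB x; rewrite ler_norml => /andP[h1 h2]; lra.
- move=> x; under eq_bigr do rewrite mulrDr.
  by rewrite big_split/= hg1 -mulr_suml hP1 mul1r addrAC.
Qed.

(** Inverting [1 - z <= expR (- z)] gives [expR z <= 1 / (1 - z)]; the right side of the claim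
    multiplied by [1 - z] exceeds 1 by [z^2 (1 - 2z)]. *)
Lemma expR_quadratic_le (z : R) : `|z| <= 1 / 2 -> expR z <= 1 + z + 2 * z ^+ 2.
Proof.
rewrite ler_norml => /andP[z1 z2].
have h := expR_ge1Dx (- z); rewrite expRN in h.
have e0 := expR_gt0 z.
have h2 : (1 - z) * expR z <= 1 by rewrite -ler_pdivlMr// div1r.
have z3 : 0 < 1 - z by lra.
have : expR z <= 1 / (1 - z) by rewrite ler_pdivlMr// mulrC.
move=> /le_trans; apply; rewrite ler_pdivrMr//.
have : 0 <= z ^+ 2 * (1 - 2 * z) by rewrite mulr_ge0 ?sqr_ge0//; lra.
nra.
Qed.

(** By the Poisson equation the increment in the exponent has mean [- eps]; for small [lam] this
    drift absorbs the second-order term of the exponential. *)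
Lemma exponential_tilt (phi g : S -> R) (G eps : R) :
  0 < eps -> (forall x, 0 <= g x <= G) ->
  (forall x, \sum_y P x y * g y = g x - phi x) ->
  exists2 lam, 0 < lam &
    forall x, \sum_y P x y * expR (lam * (phi x - eps + (g y - g x))) <= 1.
Proof.
move=> eps0 hg hgphi; have [P0 P1] := hP.
pose B : R := \sum_x `|phi x| + eps + G + 1.
pose z x y := phi x - eps + (g y - g x).
have hphi x : `|phi x| <= \sum_x `|phi x|.
  by rewrite (bigD1 x)//= lerDl sumr_ge0.
have [S0|/card_gt0P[s0 _]] := posnP #|S|.
  by exists 1 => // x; have := fintype0 x S0.
have G0 : 0 <= G by have /andP[? ?] := hg s0; lra.
have s0ge : 0 <= \sum_x `|phi x| by rewrite sumr_ge0.
have B1 : 1 <= B by rewrite /B; lra.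
have hz x y : `|z x y| <= B.
  have /andP[h1 h2] := hg x; have /andP[h3 h4] := hg y.
  have := hphi x; rewrite /z /B !ler_norml => /andP[h5 h6].
  by apply/andP; split; lra.
have B0 : 0 < B by lra.
have B20 : 0 < B ^+ 2 by rewrite exprn_gt0.
(* The first bound gives [|lam z| <= 1/2], as the quadratic estimate requires; the second gives
   [2 (lam z)^2 <= lam eps]. *)
pose lam := Num.min (1 / (2 * B)) (eps / (2 * B ^+ 2)).
have lam0 : 0 < lam.
  by rewrite lt_min !divr_gt0 ?mulr_gt0.
have lam1 : lam * B <= 1 / 2.
  have : lam <= 1 / (2 * B) by rewrite ge_min lexx.
  by rewrite ler_pdivlMr ?mulr_gt0//; lra.
have lam2 : lam * (2 * B ^+ 2) <= eps.
  have : lam <= eps / (2 * B ^+ 2) by rewrite ge_min lexx orbT.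
  by rewrite ler_pdivlMr ?mulr_gt0.
exists lam => // x.
apply: (@le_trans _ _ (\sum_y P x y * (1 + lam * z x y + lam * eps))).
  apply: ler_sum => y _; apply: ler_wpM2l => //.
  apply: le_trans (expR_quadratic_le _) _.
    rewrite normrM (gtr0_norm lam0); apply: le_trans lam1.
    by apply: ler_wpM2l (hz x y); apply: ltW.
  rewrite -/(z x y) lerD2l exprMn.
  have hz2 : z x y ^+ 2 <= B ^+ 2.
    by rewrite -real_normK ?num_real// lerXn2r ?nnegrE// ltW.
  rewrite expr2.
  have : lam * (z x y ^+ 2) <= lam * B ^+ 2 by rewrite ler_pM2l.
  move=> h; have : lam * (2 * (lam * z x y ^+ 2)) <= lam * eps.
    by rewrite ler_pM2l//; lra.
  by lra.
have -> : \sum_y P x y * (1 + lam * z x y + lam * eps) =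
  \sum_y P x y * (1 + lam * (phi x - g x)) + lam * \sum_y P x y * g y.
  rewrite mulr_sumr -big_split /=; apply: eq_bigr => y _; rewrite /z; ring.
by rewrite -mulr_suml P1 hgphi; lra.
Qed.

End PoissonEquation.

(** * Expectations as finite sums over paths *)

Lemma sum_fprod_prod (R : comPzSemiRingType) (I : finType) (T_ : I -> finType)
    (F : forall i, T_ i -> R) :
  \sum_(y : fprod T_) \prod_i F i (y i) = \prod_i \sum_(z : T_ i) F i z.
Proof.
pose F' i := [ffun z => F i z].
transitivity (\sum_(y : fprod T_) \prod_(i in I) F' i (y i)).
  by apply: eq_bigr => y _; apply: eq_bigr => i _; rewrite ffunE.
rewrite (big_fprod _ _ F') -(bigA_distr_big_dep (fun i => tagged_with T_ i)
  (fun i => untag 0 (F' i))); apply: eq_bigr => i _.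
by rewrite -(big_tag (fun i => F' i)); apply: eq_bigr => z _; rewrite ffunE.
Qed.

Lemma sum_rcons_tuple (R : nmodType) (T : finType) n (F : seq T -> R) :
  \sum_(l : n.+1.-tuple T) F l = \sum_(l : n.-tuple T) \sum_y F (rcons l y).
Proof.
rewrite pair_big /= (reindex (fun p : n.-tuple T * T => [tuple of rcons p.1 p.2])).
  by apply: eq_bigr.
exists (fun l : n.+1.-tuple T =>
  ([tuple of belast (thead l) (behead l)], last (thead l) (behead l))).
  move=> [l y] _ /=; congr pair; last first.
    by case: l => -[|a l] /= h; rewrite /thead /tnth /= ?last_rcons.
  by apply: val_inj; case: l => -[|a l] //= h; rewrite /thead /tnth /= belast_rcons.
move=> l _; apply: val_inj => /=; rewrite -lastI.
by case/tupleP: l => a l; rewrite theadE.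
Qed.

Section FiniteExpectation.
Variables (R : realType) (d : measure_display) (Omega : measurableType d).
Variable (Pr : probability Omega R).

Lemma expectation_finite_valued (I : finType) (Y : Omega -> I) (F : I -> R) :
  (forall i, measurable [set w | Y w = i]) ->
  fine ('E_Pr[fun w => F (Y w)]) =
  \sum_i fine (Pr [set w | Y w = i]) * F i.
Proof.
move=> mY.
have -> : (fun w => F (Y w)) =
    fun w => \sum_i F i * \1_[set w | Y w = i] w.
  apply/funext => w; rewrite (bigD1 (Y w))//= big1 ?addr0.
    by rewrite indicE mem_set// mulr1.
  by move=> i /eqP iY; rewrite indicE memNset ?mulr0// => h; apply: iY.
rewrite unlock /=.
have int i : Pr.-integrable setT (fun w => (F i * \1_[set w | Y w = i] w)%:E).
  apply: (eq_integrable measurableT (fun w => (F i)%:E * (\1_[set w | Y w = i] w)%:E)%E) => //.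
  by apply: integrableZl => //; apply: integrable_indic => //; rewrite setIT.
under eq_integral do rewrite -sumEFin.
rewrite integral_sum//.
have val i : (\int[Pr]_w (F i * \1_[set w | Y w = i] w)%:E)%E =
    (F i * fine (Pr [set w | Y w = i]))%:E.
  under eq_integral do rewrite EFinM.
  rewrite integralZl//; last by apply: integrable_indic => //; rewrite setIT.
  by rewrite integral_indic// setIT EFinM fineK// fin_num_measure.
rewrite (eq_bigr (fun i => (F i * fine (Pr [set w | Y w = i]))%:E))%E => [|i _].
  by rewrite sumEFin /=; apply: eq_bigr => i _; rewrite mulrC.
exact: val.
Qed.

Variables (T : finType) (X : nat -> Omega -> T).
Hypothesis mX : forall u y, measurable [set w | X u w = y].

Definition trajectory n (w : Omega) : n.-tuple T := [tuple X i.+1 w | i < n].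

Lemma measurable_trajectory n (l : n.-tuple T) :
  measurable [set w | trajectory n w = l].
Proof.
have -> : [set w | trajectory n w = l] =
    \bigcap_(i in [set: 'I_n]) [set w | X i.+1 w = tnth l i].
  apply/seteqP; split => w /= => [<- i _|h]; first by rewrite tnth_mktuple.
  by apply: eq_from_tnth => i; rewrite tnth_mktuple h.
by apply: fin_bigcap_measurable.
Qed.

Definition path_mass n (l : n.-tuple T) : R :=
  fine (Pr [set w | trajectory n w = l]).

(** [F] takes plain sequences, so that one functional can be evaluated on paths of different
    lengths. *)
Definition path_mean n (F : seq T -> R) : R :=
  \sum_(l : n.-tuple T) path_mass l * F l.

Lemma expectation_trajectory n (F : seq T -> R) :
  fine ('E_Pr[fun w => F (trajectory n w)]) = path_mean n F.
Proof.
rewrite /path_mean -(expectation_finite_valued (fun l : n.-tuple T => F l))//.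
exact: measurable_trajectory.
Qed.

Lemma path_mass_ge0 n (l : n.-tuple T) : 0 <= path_mass l.
Proof. exact: fine_ge0. Qed.

Lemma path_mean_cst n (a : R) : path_mean n (fun=> a) = a.
Proof.
by rewrite -expectation_trajectory (expectation_cst Pr a).
Qed.

Lemma path_meanD n F G :
  path_mean n (fun l => F l + G l) = path_mean n F + path_mean n G.
Proof. by rewrite -big_split; apply: eq_bigr => l _; rewrite mulrDr. Qed.

Lemma path_meanZ n a F : path_mean n (fun l => a * F l) = a * path_mean n F.
Proof. by rewrite mulr_sumr; apply: eq_bigr => l _; rewrite mulrCA. Qed.

Lemma path_meanB n F G :
  path_mean n (fun l => F l - G l) = path_mean n F - path_mean n G.
Proof. by rewrite -sumrB; apply: eq_bigr => l _; rewrite mulrBr. Qed.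

Lemma path_mean_sum n (I : Type) (r : seq I) (Q : pred I) F :
  path_mean n (fun l => \sum_(i <- r | Q i) F i l) =
  \sum_(i <- r | Q i) path_mean n (F i).
Proof.
by rewrite exchange_big; apply: eq_bigr => l _; rewrite mulr_sumr.
Qed.

Lemma ler_path_mean n F G : (forall l, size l = n -> F l <= G l) ->
  path_mean n F <= path_mean n G.
Proof.
move=> FG; apply: ler_sum => l _; apply: ler_wpM2l; first exact: path_mass_ge0.
by apply: FG; rewrite size_tuple.
Qed.

Lemma eq_path_mean n F G : (forall l, size l = n -> F l = G l) ->
  path_mean n F = path_mean n G.
Proof. by move=> FG; apply: eq_bigr => l _; rewrite FG ?size_tuple. Qed.

Variable K : seq T -> T -> R.
Hypothesis hK : forall n (l : n.+1.-tuple T) y,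
  path_mass [tuple of rcons l y] = path_mass l * K l y.

(** Conditioning on the first [n.+1] slots: by [hK], [K l y] is the probability that [y] follows the
    path [l]. *)
Lemma path_mean_step n F :
  path_mean n.+2 F = path_mean n.+1 (fun l => \sum_y K l y * F (rcons l y)).
Proof.
pose G (l : seq T) : R := fine (Pr [set w | trajectory n.+2 w = l :> seq T]) * F l.
transitivity (\sum_(l : n.+2.-tuple T) G l).
  apply: eq_bigr => l _; rewrite /G /path_mass; congr (fine (Pr _) * _).
  by apply/seteqP; split => w h; [exact: (congr1 val h)|exact: val_inj].
rewrite sum_rcons_tuple; apply: eq_bigr => l _.
rewrite mulr_sumr; apply: eq_bigr => y _; rewrite mulrA -hK /G.
congr (fine (Pr _) * _).
by apply/seteqP; split => w h; [exact: val_inj|exact: (congr1 val h)].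
Qed.

Hypothesis hK1 : forall l, (0 < size l)%N -> \sum_y K l y = 1.

(** The kernel has total mass 1, so later slots can be summed out. Estimates made at different times
    thereby hold under the mean of one common horizon. *)
Lemma path_mean_widen n m F : (0 < n <= m)%N ->
  path_mean m (fun l => F (take n l)) = path_mean n F.
Proof.
case: n => // n /= nm; rewrite -(subnKC nm); elim: (m - n.+1)%N => [|p IHp].
  by rewrite addn0; apply: eq_path_mean => l <-; rewrite take_size.
rewrite addnS addSn path_mean_step -IHp addSn; apply: eq_path_mean => l sl.
rewrite -[RHS]mul1r -(hK1 (l := l)) ?sl// mulr_suml.
by apply: eq_bigr => y _; rewrite -cats1 takel_cat// sl ltnS leq_addr.
Qed.

End FiniteExpectation.

(** Inverting the rotation names the only subepoch in which player [k] takes position [i]. This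
    serves to count exploration plays and to exclude collisions. *)
Lemma cyclic_shift_eq n (hn : (0 < n)%N) (i : 'I_n) m k :
  (m < n)%N -> (k < n)%N -> (cyclic_shift hn m k == i) = (m == (i + k) %% n)%N.
Proof.
move=> mn kn; rewrite -val_eqE /=; have hi := ltn_ord i.
have -> : ((m + n - k) %% n = if k <= m then m - k else m + n - k)%N.
  case: leqP => h; last by rewrite modn_small; lia.
  by rewrite (_ : m + n - k = (m - k) + n)%N ?modnDr ?modn_small; lia.
have -> : ((i + k) %% n = if i + k < n then i + k else i + k - n)%N.
  case: ltnP => h; first by rewrite modn_small.
  by rewrite -[in LHS](subnK h) modnDr modn_small; lia.
by apply/eqP/eqP; do 2 (case: ifP); lia.
Qed.

(** * Arithmetic of the epoch schedule, which does not depend on the observations *)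

Section Schedule.
Variables (R : realType) (M N : nat) (D : nat -> R).
Hypotheses (hM : (0 < M)%N) (hMN : (M < N)%N).

Local Notation ep := (epoch_after M N D).
Local Notation eend := (epoch_end M N).

Lemma subepoch_length_gt0 e : (0 < subepoch_length e)%N.
Proof. by rewrite /subepoch_length; case: ifP; rewrite ?muln_gt0 expn_gt0. Qed.

Lemma ep_start_lt_end e : (ep_start e < eend e)%N.
Proof.
rewrite /epoch_end -[X in (X < _)%N]addn0 ltn_add2l muln_gt0.
by rewrite subepoch_length_gt0 andbT; case: ifP => _ //; apply: ltn_trans hMN.
Qed.

Lemma epoch_afterP n : [/\ (0 < ep_start (ep n))%N, (ep_start (ep n) <= n.+1)%N
  & (n.+1 < eend (ep n))%N].
Proof.
elim: n => [|n [IH1 IH2 IH3]] /=; first by split=> //; apply: (ep_start_lt_end first_epoch).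
case: ifP => h; first by split=> //; apply: leqW.
by split=> /=; [apply: ltn_trans IH3|rewrite leqNgt h|
  exact: leq_ltn_trans IH3 (ep_start_lt_end (next_epoch M N D (ep n)))].
Qed.

(** [ep n.+1] is the epoch of slot [n.+2]. As slot [n.+1] lies before the end of [ep n], the end is
    never overshot: a new epoch starts exactly there. *)
Variant epoch_spec n : epoch -> Prop :=
| EpochContinues of (n.+2 < eend (ep n))%N : epoch_spec n (ep n)
| EpochStarts of n.+2 = eend (ep n) : epoch_spec n (next_epoch M N D (ep n)).

Lemma epochP n : epoch_spec n (ep n.+1).
Proof.
rewrite /=; case: ifP => h; constructor => //.
by apply/eqP; rewrite eqn_leq [X in _ && X]leqNgt h andbT; have [_ _] := epoch_afterP n.
Qed.

Lemma epoch_after_start n : ep (ep_start (ep n)).-1 = ep n.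
Proof.
elim: n => // n IHn; case: epochP => [//|h].
rewrite (_ : (ep_start _).-1 = n.+1); last by rewrite /= -h.
by case: epochP => // h'; rewrite h ltnn in h'.
Qed.

Definition subepoch_index n := ((n.+1 - ep_start (ep n)) %/ subepoch_length (ep n))%N.

Lemma subepoch_index_lt n :
  (subepoch_index n < if ep_exploit (ep n) then M else N)%N.
Proof.
have [_ h1 h2] := epoch_afterP n.
rewrite /subepoch_index ltn_divLR ?subepoch_length_gt0//.
by rewrite ltn_subLR.
Qed.

Lemma exploitation_testP n : ep_exploit (ep n) ->
  exploitation_test D (ep_start (ep n)) (ep_nO (ep n)).
Proof. by elim: n => // n IHn; case: epochP. Qed.

(** Geometric sums: the completed epochs take [N (4^nO - 1) / 3] and [2M (4^nI - 1) / 3] slots, and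
    the first slot is 1; divisions and subtractions are cleared. *)
Lemma epoch_start_eq n :
  (N * 4 ^ ep_nO (ep n) + 2 * M * 4 ^ ep_nI (ep n) + 3
   = 3 * ep_start (ep n) + N + 2 * M)%N.
Proof.
elim: n => [|n IHn]; first by rewrite /= !expn0; lia.
case: epochP => [//|h] /=.
rewrite /epoch_end /subepoch_length.
by case: (ep_exploit _); rewrite /= ?addn0 ?addn1 ?expnS; lia.
Qed.

Lemma exploration_pow_le n : (4 ^ ep_nO (ep n) <= 3 * ep_start (ep n))%N.
Proof.
have h := epoch_start_eq n; have := expn_gt0 4 (ep_nI (ep n)).
have := expn_gt0 4 (ep_nO (ep n)); have [h0 _ _] := epoch_afterP n.
move: (4 ^ _)%N (4 ^ _)%N h => a b h /= a0 b0.
nia.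
Qed.

Lemma exploitation_pow_le n : (4 ^ ep_nI (ep n) <= 3 * ep_start (ep n))%N.
Proof.
have h := epoch_start_eq n; have := expn_gt0 4 (ep_nI (ep n)).
have := expn_gt0 4 (ep_nO (ep n)); have [h0 _ _] := epoch_afterP n.
move: (4 ^ _)%N (4 ^ _)%N h => a b h /= a0 b0.
nia.
Qed.

(** By [epoch_start_eq] an exploitation epoch starting at [tau] has length at most [3 tau + 2M].
    Hence a bound of order [1 / tau] is also one of order [1 / n.+1]. *)
Lemma exploitation_slot_le n : ep_exploit (ep n) ->
  (n.+1 <= (4 + 2 * M) * ep_start (ep n))%N.
Proof.
move=> hx; have [h0 _] := epoch_afterP n.
rewrite /epoch_end /subepoch_length hx.
have h := epoch_start_eq n; have := expn_gt0 4 (ep_nO (ep n)).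
move: (4 ^ _)%N (4 ^ _)%N h => a b h /= a0.
nia.
Qed.

Let addn_negb a b (x : bool) : (a + ~~ x + (b + x) = (a + b).+1)%N.
Proof. by case: x => /=; lia. Qed.

(* Bounds the number of maximal runs of slots in which a player keeps its arm, up
   to slot [n.+1]. *)
Definition block_bound n :=
  (N * (ep_nO (ep n) + ep_nI (ep n)) + subepoch_index n).+1.

(** When a new epoch starts, the subepoch index, which is below [N], falls to 0, but the epoch term
    gains [N]. The increase is thus strict, which [block_bound_eq] exploits. *)
Lemma block_bound_mono n : (block_bound n <= block_bound n.+1)%N.
Proof.
rewrite /block_bound ltnS /subepoch_index; case: epochP => h.
  by rewrite leq_add2l leq_div2r// leq_sub2r.
rewrite /= -h subnn div0n addn0 addn_negb mulnS addnC leq_add2r.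
have := subepoch_index_lt n; rewrite /subepoch_index; case: ifP => _; last exact: ltnW.
by move=> /ltn_trans/(_ hMN)/ltnW.
Qed.

Lemma block_bound_eq n : block_bound n.+1 = block_bound n ->
  ep n.+1 = ep n /\ subepoch_index n.+1 = subepoch_index n.
Proof.
rewrite /block_bound /subepoch_index => /eqP; rewrite eqSS; case: epochP => h.
  by rewrite eqn_add2l => /eqP.
rewrite /= -h subnn div0n addn0 addn_negb mulnS addnC eqn_add2l => /eqP E.
have := subepoch_index_lt n; rewrite /subepoch_index -E; case: ifP => _; last by rewrite ltnn.
by move=> /ltn_trans/(_ hMN); rewrite ltnn.
Qed.

Lemma block_bound_start n : (ep_start (ep n)).-1 = n ->
  block_bound n = (N * (ep_nO (ep n) + ep_nI (ep n))).+1.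
Proof.
have [h0 _ _] := epoch_afterP n.
by move=> h; rewrite /block_bound /subepoch_index -[in n.+1]h prednK// subnn div0n addn0.
Qed.

Definition exploration_count n := (\sum_(u < n) ~~ ep_exploit (ep u))%N.

(** Completed exploration epochs contribute a geometric sum, and a running one the slots elapsed
    since its start. *)
Lemma exploration_count_eq n :
  (3 * exploration_count n + N = N * 4 ^ ep_nO (ep n)
   + 3 * (if ep_exploit (ep n) then 0 else n.+1 - ep_start (ep n)))%N.
Proof.
rewrite /exploration_count; elim: n => [|n IHn].
  by rewrite big_ord0 /= subnn expn0; lia.
have [_ h1 h2] := epoch_afterP n; move: IHn.
case: epochP => h; rewrite big_ord_recr [in \sum_(i < n) _]/=.
  by case: ifP => _ /=; lia.
rewrite /= -h subnn if_same muln0 addn0; move: h; rewrite /epoch_end /subepoch_length.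
by case: (ep_exploit _) => /= h; rewrite ?addn0 ?addn1 ?expnS; lia.
Qed.

Lemma exploration_countS_le n :
  (3 * exploration_count n.+1 + N
   <= N * 4 ^ (ep_nO (ep n) + ~~ ep_exploit (ep n)))%N.
Proof.
have := exploration_count_eq n; have [_ h1] := epoch_afterP n.
rewrite /exploration_count big_ord_recr /= /epoch_end /subepoch_length.
by case: (ep_exploit _) => /=; rewrite ?addn0 ?addn1 ?expnS; lia.
Qed.

(** An exploration epoch after the first starts only when the test fails, which bounds [4^nO] by the
    value of [D t * ln t] at its start. The monotone majorant [B] carries this bound to later slots,
    as [D] may oscillate. *)
Lemma exploration_count_le (B : nat -> R) n :
  (forall t, 0 <= B t) -> (forall t u, (t <= u)%N -> B t <= B u) ->
  (forall t, (0 < t)%N -> D t * ln t%:R <= B t) ->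
  (exploration_count n.+1)%:R <= N%:R * (4 * B n.+1 + 1).
Proof.
move=> B0 Bmono DB.
(* A running exploration epoch is counted as complete, so this power changes only when a new
   exploration epoch starts. *)
suff h : (4 ^ (ep_nO (ep n) + ~~ ep_exploit (ep n)))%:R <=
    4 * (3 * B (ep_start (ep n)) + 1) :> R.
  have [_ h2 _] := epoch_afterP n; have := Bmono _ _ h2.
  have := exploration_countS_le n; rewrite -(ler_nat R) natrD !natrM.
  move: h; move: (4 ^ _)%:R (B _) (B _) => p b b' h1 h2' h3.
  have : N%:R * p <= N%:R * (4 * (3 * b + 1)) by rewrite ler_wpM2l//; lra.
  by move: (exploration_count n.+1)%:R (N%:R) h2' => e c; lra.
elim: n => [|n IHn]; first by rewrite /=; have := B0 1%N; lra.
have [h0 _ _] := epoch_afterP n.+1; case: (ep n.+1) / (epochP n) h0 => // h.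
rewrite [ep_start _]/= => h3; have [h0 h1 h2] := epoch_afterP n.
rewrite /next_epoch /=.
case: (boolP (exploitation_test _ _ _)) => /=; rewrite /exploitation_test.
  move=> _; rewrite addn0; apply: le_trans IHn _; rewrite ler_pM2l// lerD2r ler_pM2l//.
  by apply: Bmono; rewrite -h; apply: leqW.
rewrite -leNgt => h4; rewrite addn1 expnS natrM ler_pM2l//.
have := le_trans h4 (DB _ h3); rewrite ler_pdivrMr// natrX.
by clear; move: (_ ^+ _) (B _) => p b; lra.
Qed.

Definition exploration_arm (k : 'I_M) n : 'I_N :=
  cyclic_shift (leq_ltn_trans (leq0n M) hMN) (subepoch_index n) k.

Definition exploration_plays (k : 'I_M) (i : 'I_N) n :=
  (\sum_(u < n) (~~ ep_exploit (ep u) && (exploration_arm k u == i)))%N.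

Lemma exploration_plays_ge k i n :
  (4 ^ ep_nO (ep n) <= 3 * exploration_plays k i n + 1)%N.
Proof.
pose q := ((i + k) %% N)%N.
have N0 : (0 < N)%N by apply: leq_ltn_trans hMN.
have qN : (q < N)%N by rewrite ltn_mod.
have kN : (k < N)%N by apply: ltn_trans hMN.
(* For the induction, the plays of [i] in a running exploration epoch are added: the elapsed part of
   subepoch [q], truncated at 0 and at the subepoch length. *)
suff : (4 ^ ep_nO (ep n) + 3 * (if ep_exploit (ep n) then 0 else
    minn (subepoch_length (ep n))
      (n.+1 - ep_start (ep n) - q * subepoch_length (ep n)))
    <= 3 * exploration_plays k i n + 1)%N.
  by apply: leq_trans; rewrite leq_addr.
rewrite /exploration_plays; elim: n => [|n IHn].
  by rewrite big_ord0 /= sub0n minn0.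
have [h0 h1 h2] := epoch_afterP n.
have hx : ~~ ep_exploit (ep n) -> (minn (subepoch_length (ep n))
      (n.+2 - ep_start (ep n) - q * subepoch_length (ep n)) =
      minn (subepoch_length (ep n))
      (n.+1 - ep_start (ep n) - q * subepoch_length (ep n)) +
      (exploration_arm k n == i))%N.
  move=> hx; rewrite /exploration_arm cyclic_shift_eq//; last first.
    by have := subepoch_index_lt n; rewrite (negPf hx).
  rewrite -/q /subepoch_index.
  have l0 := subepoch_length_gt0 (ep n).
  have := leq_divRL q (n.+1 - ep_start (ep n)) l0.
  have := ltn_divLR (n.+1 - ep_start (ep n)) q.+1 l0.
  rewrite mulSn ltnS eqn_leq => -> ->; lia.
move: IHn; case: epochP => h; rewrite big_ord_recr.
  by case: ifP hx => [_ _|_ /(_ isT) ->] /=; lia.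
rewrite /= -h subnn sub0n minn0 if_same muln0 addn0.
move: h hx; rewrite /epoch_end /subepoch_length.
case: (ep_exploit _) => /= h; first by rewrite !addn0; lia.
move=> /(_ isT); rewrite h (addn1 (ep_nO _)) expnS.
have -> : (ep_start (ep n) + N * 4 ^ ep_nO (ep n) - ep_start (ep n) - q * 4 ^ ep_nO (ep n)
  = (N - q) * 4 ^ ep_nO (ep n))%N by rewrite mulnBl addKn.
have -> : minn (4 ^ ep_nO (ep n)) ((N - q) * 4 ^ ep_nO (ep n)) = (4 ^ ep_nO (ep n))%N.
  by apply/minn_idPl; rewrite leq_pmull// subn_gt0.
by lia.
Qed.

End Schedule.

(** * Local histories as nonanticipating functions of the states *)

Section LocalHistories.
Variables (R : realType) (M N : nat) (Phi : policy R M N).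

Lemma eq_local_history x x' k n :
  (forall j u, (0 < u <= n)%N -> x j u = x' j u) ->
  local_history Phi x k n = local_history Phi x' k n.
Proof.
elim: n => //= n IHn h; rewrite IHn => [|j u /andP[u0 un]].
  by rewrite h ?leqnn.
by apply: h; rewrite u0 leqW.
Qed.

Lemma eq_arm_of x x' k t :
  (forall j u, (0 < u < t)%N -> x j u = x' j u) ->
  arm_of Phi x k t = arm_of Phi x' k t.
Proof.
move=> h; rewrite /arm_of (@eq_local_history x x')// => j u /andP[u0 ut].
by apply: h; rewrite u0 (leq_ltn_trans ut)// prednK// (leq_trans u0)// (leq_trans ut)// leq_pred.
Qed.

Lemma eq_engaged x x' j t :
  (forall j u, (0 < u < t)%N -> x j u = x' j u) ->
  engaged Phi x j t = engaged Phi x' j t.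
Proof. by move=> h; apply: eq_existsb => k; rewrite (eq_arm_of _ h). Qed.

Lemma size_local_history x k n : size (local_history Phi x k n) = n.
Proof. by elim: n => //= n IHn; rewrite size_rcons IHn. Qed.

Lemma take_local_history x k m n : (m <= n)%N ->
  take m (local_history Phi x k n) = local_history Phi x k m.
Proof.
elim: n => [|n IHn]; first by rewrite leqn0 => /eqP ->.
rewrite leq_eqVlt => /predU1P[->|]; first by rewrite take_oversize ?size_local_history.
rewrite ltnS => mn; rewrite /= -cats1 takel_cat ?size_local_history// IHn//.
Qed.

Lemma play_count_local_history x k n i :
  play_count (local_history Phi x k n) i = (\sum_(u < n) (arm_of Phi x k u.+1 == i))%N.
Proof.
elim: n => [|n IHn]; first by rewrite big_ord0.
rewrite big_ord_recr -IHn /= -cats1 /play_count count_cat /= addn0.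
by rewrite /arm_of.
Qed.

Lemma sum_local_history x k n i :
  \sum_(o <- local_history Phi x k n | o.1 == i) o.2 =
  \sum_(u < n | arm_of Phi x k u.+1 == i) x i u.+1.
Proof.
elim: n => [|n IHn]; first by rewrite big_ord0 big_nil.
rewrite [RHS]big_mkcond big_ord_recr -big_mkcond -IHn /= -cats1 big_cat /=.
congr (_ + _); by rewrite big_mkcond big_seq1 /arm_of /=; case: eqP => // ->.
Qed.

End LocalHistories.

(** * The joint process of the arms: kernel, martingale and supermartingale *)

Section Process.
Variables (R : realType) (M N : nat) (S : 'I_N -> {fset R}).
Variables (P : forall j, S j -> S j -> R) (Phi : policy R M N).
Variables (d : measure_display) (Omega : measurableType d).
Variables (Pr : probability Omega R) (s : forall j, nat -> Omega -> S j).
Arguments P : clear implicits.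
Arguments s : clear implicits.
Hypothesis hs : exogenous_process P Phi Pr s.
Hypothesis hP : forall j, stochastic (P j).

(** The arms have different state spaces, so a joint state is a dependent finite function. *)
Definition joint_state : finType := fprod (fun j : 'I_N => S j).

Variable y0 : joint_state.

Definition joint_process u w : joint_state := fprod_of_fun (fun j => s j u w).

(** Slots start at 1 and path entries at 0; [y0] is the default beyond the end of the path. *)
Definition path_states (l : seq joint_state) (j : 'I_N) (u : nat) : R :=
  val (nth y0 l u.-1 j).

Lemma measurable_joint_process u y : measurable [set w | joint_process u w = y].
Proof.
have -> : [set w | joint_process u w = y] =
    \bigcap_(i in [set: 'I_N]) [set w | s i u w = y i].
  apply/seteqP; split => w /= => [<- i _|h]; first by rewrite fprodE.
  by apply/fprodP => i; rewrite fprodE h.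
by apply: fin_bigcap_measurable => // i _; apply: (process_measurable hs).
Qed.

Definition joint_kernel (l : seq joint_state) (y : joint_state) : R :=
  \prod_(j < N) if engaged Phi (path_states l) j (size l)
    then P j (nth y0 l (size l).-1 j) (y j)
    else (y j == nth y0 l (size l).-1 j)%:R.

Lemma path_states_rcons l y j u : (0 < u <= size l)%N ->
  path_states (rcons l y) j u = path_states l j u.
Proof.
move=> /andP[u0 ul]; rewrite /path_states nth_rcons.
by rewrite (leq_trans _ ul)// prednK.
Qed.

Local Notation mass := (path_mass Pr joint_process).
Local Notation mean := (path_mean Pr joint_process).

Lemma path_mass_step n (l : n.+1.-tuple joint_state) y :
  mass [tuple of rcons l y] = mass l * joint_kernel l y.
Proof.
pose x j u := nth y0 (rcons l y) u.-1 j.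
have := process_step hs x (ltn0Sn n).
have sl : size l = n.+1 by rewrite size_tuple.
have -> : [set w | forall j u, (0 < u <= n.+2)%N -> s j u w = x j u] =
    [set w | trajectory joint_process n.+2 w = [tuple of rcons l y]].
  apply/seteqP; split => w /= h.
    apply: eq_from_tnth => i; rewrite tnth_mktuple; apply/fprodP => j.
    by rewrite fprodE h ?ltn_ord// (tnth_nth y0).
  move=> j [//|u] /= un; rewrite /x /= -[rcons l y]/(val [tuple of rcons l y]) -h /=.
  by rewrite (nth_map (Ordinal un)) ?size_enum_ord// nth_enum_ord// fprodE.
have -> : [set w | forall j u, (0 < u <= n.+1)%N -> s j u w = x j u] =
    [set w | trajectory joint_process n.+1 w = l].
  apply/seteqP; split => w /= h.
    apply: eq_from_tnth => i; rewrite tnth_mktuple; apply/fprodP => j.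
    rewrite fprodE h ?ltn_ord// (tnth_nth y0) /x /= nth_rcons sl.
    by rewrite ltn_ord.
  move=> j [//|u] /= un; rewrite /x /= nth_rcons sl un -h /=.
  by rewrite (nth_map (Ordinal un)) ?size_enum_ord// nth_enum_ord// fprodE.
rewrite /path_mass => ->; rewrite fineM ?fin_num_measure//=; last first.
  exact: measurable_trajectory measurable_joint_process _ _.
congr (_ * _); apply: eq_bigr => j _; rewrite sl.
rewrite (@eq_engaged _ _ _ _ _ (path_states l)); last first.
  move=> i u /andP[u0 un]; apply: (path_states_rcons y i).
  by rewrite u0 sl ltnW.
by rewrite /x /= !nth_rcons sl ltnn eqxx ltnSn.
Qed.

(** The kernel is a product over the arms; the factors of the arms other than [j] sum to 1. *)
Lemma joint_kernel_mean l (phi : forall j, S j -> R) j :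
  \sum_y joint_kernel l y * phi j (y j) =
  if engaged Phi (path_states l) j (size l)
  then \sum_z P j (nth y0 l (size l).-1 j) z * phi j z
  else phi j (nth y0 l (size l).-1 j).
Proof.
pose k i z := if engaged Phi (path_states l) i (size l)
    then P i (nth y0 l (size l).-1 i) z else (z == nth y0 l (size l).-1 i)%:R.
pose F i z := k i z * (if i == j then phi i z else 1).
have k1 i : \sum_z k i z = 1.
  rewrite /k; case: (engaged _ _ _ _); first by have [_ ->] := hP i.
  by rewrite (bigD1 (nth y0 l (size l).-1 i))//= eqxx big1 ?addr0// => z /negPf ->.
transitivity (\sum_(y : joint_state) \prod_i F i (y i)).
  apply: eq_bigr => y _; rewrite /F big_split /=; congr (_ * _).
  by rewrite (bigD1 j)//= eqxx big1 ?mulr1// => i /negPf ->.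
rewrite sum_fprod_prod (bigD1 j)//= [X in _ * X]big1 ?mulr1 => [|i /negPf ij].
  rewrite /F /k eqxx; case: (engaged _ _ _ _) => //.
  rewrite (bigD1 (nth y0 l (size l).-1 j))//= eqxx mul1r big1 ?addr0// => z /negPf ->.
  by rewrite mul0r.
by rewrite /F ij -[RHS](k1 i); apply: eq_bigr => z _; rewrite mulr1.
Qed.

Lemma joint_kernel_sum1 l : (0 < N)%N -> \sum_y joint_kernel l y = 1.
Proof.
move=> N0; have := joint_kernel_mean l (fun _ _ => 1) (Ordinal N0).
under eq_bigr do rewrite mulr1.
move=> ->; case: ifP => // _; under eq_bigr do rewrite mulr1.
by have [_ ->] := hP (Ordinal N0).
Qed.

Lemma engaged_rcons l y j u : (u <= (size l).+1)%N ->
  engaged Phi (path_states (rcons l y)) j u = engaged Phi (path_states l) j u.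
Proof.
move=> ul; apply: eq_engaged => i v /andP[v0 vu]; apply: path_states_rcons.
by rewrite v0 -ltnS (leq_trans vu).
Qed.

Lemma arm_of_rcons l y k u : (u <= (size l).+1)%N ->
  arm_of Phi (path_states (rcons l y)) k u = arm_of Phi (path_states l) k u.
Proof.
move=> ul; apply: eq_arm_of => i v /andP[v0 vu]; apply: path_states_rcons.
by rewrite v0 -ltnS (leq_trans vu).
Qed.

Variables (phi g : forall j, S j -> R) (G : R).
Arguments phi : clear implicits.
Arguments g : clear implicits.
Hypothesis hg : forall j x, 0 <= g j x <= G.
Hypothesis hphi : forall j x, \sum_y P j x y * g j y = g j x - phi j x.

Definition engaged_sum j n l : R :=
  \sum_(u < n | engaged Phi (path_states l) j u.+1) phi j (nth y0 l u j).

(* The engaged sum plus [g] of the current state is a martingale: by the Poisson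
   equation when the arm is played, and because its state is frozen otherwise. *)
Lemma engaged_sum_martingale j n :
  mean n.+1 (fun l => engaged_sum j n l + g j (nth y0 l n j)) =
  mean 1 (fun l => g j (nth y0 l 0 j)).
Proof.
have N0 : (0 < N)%N by apply: leq_ltn_trans (ltn_ord j).
elim: n => [|n IHn].
  by apply: eq_path_mean => l _; rewrite /engaged_sum big_ord0 add0r.
rewrite -IHn (path_mean_step path_mass_step); apply: eq_path_mean => l sl.
rewrite (eq_bigr (fun y => (engaged_sum j n.+1 l) * joint_kernel l y +
    joint_kernel l y * g j (y j))) => [|y _].
  rewrite big_split/= -mulr_sumr joint_kernel_sum1// mulr1 (joint_kernel_mean l g).
  rewrite hphi sl /engaged_sum big_mkcond big_ord_recr -big_mkcond /=.
  by case: ifP => _; ring.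
rewrite mulrDr nth_rcons sl ltnn eqxx mulrC; congr (_ * _ + _).
rewrite /engaged_sum; apply: eq_big => u; rewrite ?engaged_rcons// ?sl.
- by apply: leqW; apply: ltn_ord.
- by rewrite nth_rcons sl ltn_ord.
- by apply: leqW; apply: ltn_ord.
Qed.

(** The values of [g] at both ends of the martingale identity lie between 0 and [G], whence a bound
    uniform in [n]. *)
Lemma engaged_sum_mean j n : `|mean n.+1 (engaged_sum j n)| <= G.
Proof.
have := engaged_sum_martingale j n; rewrite path_meanD.
have b m u : 0 <= mean m (fun l => g j (nth y0 l u j)) <= G.
  rewrite -[X in X <= _ <= _](path_mean_cst Pr measurable_joint_process m).
  rewrite -[X in _ <= _ <= X](path_mean_cst Pr measurable_joint_process m).
  by apply/andP; split; apply: ler_path_mean => l _; case/andP: (hg (nth y0 l u j)).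
have /andP[h1 h2] := b 1%N 0%N; have /andP[h3 h4] := b n.+1 n.
by rewrite ler_norml => h; apply/andP; split; lra.
Qed.

Variables (eps lam : R) (i : 'I_N) (k : 'I_M).
Hypothesis lam0 : 0 < lam.
Hypothesis htilt : forall x,
  \sum_y P i x y * expR (lam * (phi i x - eps + (g i y - g i x))) <= 1.

(** Only the slots in which player [k] itself plays [i] enter. The differences of [g] telescope
    within a run of such slots but not across a gap, where other players may move the arm. *)
Definition observed_exponent n l : R :=
  \sum_(u < n | arm_of Phi (path_states l) k u.+1 == i)
    (phi i (nth y0 l u i) - eps + (g i (nth y0 l u.+1 i) - g i (nth y0 l u i))).

(** Given the past, the next factor has mean at most 1 by [htilt] if player [k] plays [i], since the
    arm is then engaged, and equals 1 otherwise. *)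
Lemma observed_supermartingale n :
  mean n.+1 (fun l => expR (lam * observed_exponent n l)) <= 1.
Proof.
have N0 : (0 < N)%N by apply: leq_ltn_trans (ltn_ord i).
elim: n => [|n IHn].
  rewrite (eq_path_mean _ _ (G := fun=> 1)) ?(path_mean_cst _ measurable_joint_process)//.
  by move=> l _; rewrite /observed_exponent big_ord0 mulr0 expR0.
apply: le_trans IHn; rewrite (path_mean_step path_mass_step); apply: ler_path_mean => l sl.
pose x := nth y0 l n i.
pose Q (z : S i) := if arm_of Phi (path_states l) k n.+1 == i
  then expR (lam * (phi i x - eps + (g i z - g i x))) else 1.
rewrite (eq_bigr (fun y => expR (lam * observed_exponent n l) *
    (joint_kernel l y * Q (y i)))) => [|y _].
  rewrite -mulr_sumr -[X in _ <= X]mulr1 ler_pM2l ?expR_gt0//.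
  have [hx|hx] := boolP (arm_of Phi (path_states l) k n.+1 == i); last first.
    rewrite (eq_bigr (joint_kernel l)) ?joint_kernel_sum1// => y _.
    by rewrite /Q (negPf hx) mulr1.
  have := joint_kernel_mean l (fun j z => expR (lam * (phi i x - eps + (g j z - g i x)))) i.
  rewrite sl (_ : engaged _ _ _ _ = true) => [h|]; last by apply/existsP; exists k.
  apply: le_trans (htilt x); rewrite -h.
  by apply: ler_sum => y _; rewrite /Q hx.
rewrite mulrCA; congr (_ * _); rewrite /observed_exponent.
have E : \sum_(u < n | arm_of Phi (path_states (rcons l y)) k u.+1 == i)
    (phi i (nth y0 (rcons l y) u i) - eps +
     (g i (nth y0 (rcons l y) u.+1 i) - g i (nth y0 (rcons l y) u i))) =
   \sum_(u < n | arm_of Phi (path_states l) k u.+1 == i)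
    (phi i (nth y0 l u i) - eps + (g i (nth y0 l u.+1 i) - g i (nth y0 l u i))).
  apply: eq_big => u; rewrite ?arm_of_rcons// ?sl.
  - by apply: leqW; apply: leqW; apply: ltn_ord.
  - by rewrite !nth_rcons sl !ltnS ltn_ord (ltnW (ltn_ord u)).
  - by apply: leqW; apply: leqW; apply: ltn_ord.
rewrite big_mkcond big_ord_recr -big_mkcond /= E mulrDr expRD; congr (_ * _).
rewrite /Q arm_of_rcons ?sl// !nth_rcons sl ltnSn ltnn eqxx -/x.
by case: ifP => // _; rewrite mulr0 expR0.
Qed.

End Process.

(* [K] counts at least the maximal runs of [sel] started up to index [n]; each
   run costs at most the oscillation [G] of [a]. *)
Lemma telescoping_runs_ge (R : realFieldType) (a : nat -> R) (G : R)
    (sel : nat -> bool) (K : nat -> nat) n :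
  (forall u, 0 <= a u <= G) -> (0 < K 0)%N ->
  (forall u, (K u <= K u.+1)%N) ->
  (forall u, ~~ sel u -> sel u.+1 -> (K u < K u.+1)%N) ->
  - (G * (K n)%:R) <= \sum_(u < n | sel u) (a u.+1 - a u).
Proof.
move=> ha K0 Kmono Ksel.
have G0 : 0 <= G by have /andP[] := ha 0%N; apply: le_trans.
(* In an open run [a n] is kept in reserve, to pay for its subtraction in the next difference. *)
suff : - (G * (K n)%:R) + (if sel n then a n else 0) <=
    \sum_(u < n | sel u) (a u.+1 - a u).
  by apply: le_trans; rewrite lerDl; case: ifP => // _; case/andP: (ha n).
elim: n => [|n IHn].
  rewrite big_ord0 addrC subr_le0; apply: (@le_trans _ _ G).
    by case: ifP => // _; case/andP: (ha 0%N).
  by rewrite ler_peMr// ler1n.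
rewrite big_mkcond big_ord_recr -big_mkcond /=.
have hn := ha n.+1.
have hK : G * (K n)%:R <= G * (K n.+1)%:R by rewrite ler_wpM2l// ler_nat.
case: ifP IHn => hs IHn; first by case: ifP => _; case/andP: hn; lra.
case: ifP => hs1; last by lra.
have : G * ((K n).+1)%:R <= G * (K n.+1)%:R.
  by rewrite ler_wpM2l// ler_nat Ksel// hs.
by rewrite -natr1 mulrDr mulr1; case/andP: hn; lra.
Qed.

(** * The [M] best arms, and the income in good and bad slots *)

Section TopArms.
Variables (R : realType) (M N : nat) (hMN : (M < N)%N) (mu : 'I_N -> R).
Variable (sigma : 'S_N).
Hypotheses (hmu : injective mu) (hsigma : ranks_means mu sigma).

Definition top_arm (j : 'I_N) : bool := ((sigma^-1)%g j < M)%N.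

Lemma card_top_arm : #|[set j | top_arm j]%SET| = M.
Proof.
have -> : [set j | top_arm j]%SET = [set sigma (widen_ord (ltnW hMN) m) | m : 'I_M]%SET.
  apply/setP => j; rewrite inE; apply/idP/imsetP => [h|[m _ ->]].
    by exists (Ordinal h) => //; rewrite -[LHS](permKV sigma); congr (sigma _); apply: val_inj.
  by rewrite /top_arm permK /=.
by rewrite card_imset ?card_ord// => m m' /perm_inj /(congr1 val) /= /val_inj.
Qed.

Lemma sum_top_arm : \sum_(i < N | (i < M)%N) mu (sigma i) = \sum_(j | top_arm j) mu j.
Proof.
rewrite [RHS](reindex_inj (@perm_inj _ sigma)) /=.
by apply: eq_bigl => i; rewrite /top_arm permK.
Qed.

Lemma mu_sigma_lt (i j : 'I_N) : (mu (sigma j) < mu (sigma i)) = (i < j)%N.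
Proof.
apply/idP/idP => [|ij].
  by rewrite ltnNge; apply: contraTN => ji; rewrite -leNgt; apply: hsigma.
rewrite lt_neqAle hsigma ?andbT; last exact: ltnW.
by apply/eqP => /hmu /perm_inj E; rewrite E ltnn in ij.
Qed.

(** The ranks [r] of the listed arms increase strictly, and by [rdown] every arm better than a
    listed one is listed earlier. Hence [r] is the identity. *)
Lemma top_arms_sigma (ind : 'I_N -> R) (a : 'I_M -> 'I_N) :
  (forall i j, mu i < mu j -> ind i < ind j) -> top_arms ind a ->
  forall m, a m = sigma (widen_ord (ltnW hMN) m).
Proof.
move=> hind [ainj amono aout] m.
pose r m := (sigma^-1)%g (a m).
have ar m' : a m' = sigma (r m') by rewrite permKV.
have rlt (m1 m2 : 'I_M) : (m1 < m2)%N -> (r m1 < r m2)%N.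
  move=> m12; rewrite -mu_sigma_lt -!ar.
  have [//|h|h] := ltgtP (mu (a m2)) (mu (a m1)).
    by have := hind _ _ h; rewrite ltNge amono// ltnW.
  by move/hmu/ainj: h m12 => ->; rewrite ltnn.
have rdown (m1 : 'I_M) (i : 'I_N) : (i < r m1)%N -> exists2 m2 : 'I_M, (m2 < m1)%N & r m2 = i.
  move=> im1.
  have [m2 /eqP am2|h] := pickP (fun m2 => a m2 == sigma i).
    have rm2 : r m2 = i by rewrite /r am2 permK.
    exists m2 => //; rewrite ltnNge; apply/negP; rewrite leq_eqVlt => /predU1P[E|/rlt].
      by move: im1; rewrite -rm2 (val_inj E) ltnn.
    by rewrite rm2 ltnNge ltnW.
  have := aout (sigma i) (fun m2 => elimF eqP (h m2)) m1.
  by rewrite leNgt hind// ar mu_sigma_lt.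
suff rm : r m = m :> nat by rewrite ar; congr (sigma _); apply: val_inj.
elim/ltn_ind: (m : nat) {-2}m (erefl (m : nat)) => n IHn {}m mn.
apply/eqP; rewrite eqn_leq; apply/andP; split; rewrite leqNgt; apply/negP => h.
  have [m2 m2m] := rdown m (widen_ord (ltnW hMN) m) h.
  move/(congr1 val) => /=; rewrite (IHn m2)// -?mn// => E.
  by rewrite E ltnn in m2m.
have hM' : (r m < M)%N by apply: ltn_trans h _.
have := IHn _ _ (Ordinal hM') (erefl _) => /= /(_ _) E.
have {}E : r (Ordinal hM') = r m :> nat by apply: E; rewrite -mn.
by have := rlt (Ordinal hM') m h; rewrite E ltnn.
Qed.

Hypothesis hmu0 : forall j, 0 <= mu j.

(** With the best mean [th] outside the top arms subtracted, top arms contribute nonnegative terms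
    and the others nonpositive ones; [th >= 0] settles the remaining multiples of [th]. *)
Lemma sum_le_top (A : {set 'I_N}) : (#|A| <= M)%N ->
  \sum_(j in A) mu j <= \sum_(j | top_arm j) mu j.
Proof.
move=> hA; pose th := mu (sigma (Ordinal hMN)).
have htop j : top_arm j -> th <= mu j.
  by move=> h; rewrite -(permKV sigma j); apply: hsigma; rewrite /= ltnW.
have hntop j : ~~ top_arm j -> mu j <= th.
  by rewrite /top_arm -leqNgt => h; rewrite -(permKV sigma j); apply: hsigma.
have E (B : {pred 'I_N}) : \sum_(j in B) mu j = \sum_(j in B) (mu j - th) + th * #|B|%:R.
  by rewrite big_split /= sumrN sumr_const mulr_natr addrNK.
have -> : \sum_(j | top_arm j) mu j = \sum_(j in [set j | top_arm j]%SET) mu j.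
  by apply: eq_bigl => j; rewrite inE.
rewrite !E card_top_arm lerD//; last first.
  by rewrite ler_wpM2l ?hmu0// ler_nat.
rewrite [leLHS]big_mkcond [leRHS]big_mkcond; apply: ler_sum => j _.
rewrite inE; case: ifP => _; case: (boolP (top_arm j)) => h //.
  by rewrite subr_le0 hntop.
by rewrite subr_ge0 htop.
Qed.

Variables (Phi : policy R M N) (x : 'I_N -> nat -> R).

Definition good_slot u : bool :=
  injectiveb (fun k => arm_of Phi x k u) && [forall k, top_arm (arm_of Phi x k u)].

Lemma card_engaged_le u : (#|[set j | engaged Phi x j u]%SET| <= M)%N.
Proof.
have -> : [set j | engaged Phi x j u]%SET = [set arm_of Phi x k u | k : 'I_M]%SET.
  apply/setP => j; rewrite inE; apply/existsP/imsetP => [[k /eqP <-]|[k _ ->]].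
    by exists k.
  by exists k.
by apply: leq_trans (leq_imset_card _ _) _; rewrite card_ord.
Qed.

Lemma good_slot_engaged u j : good_slot u -> engaged Phi x j u = top_arm j.
Proof.
move=> /andP[/injectiveP inj /forallP top].
have /eqP/setP/(_ j) : [set arm_of Phi x k u | k : 'I_M]%SET == [set j | top_arm j]%SET.
  rewrite eqEcard card_top_arm card_imset// card_ord leqnn andbT.
  by apply/fintype.subsetP => _ /imsetP[k _ ->]; rewrite inE.
rewrite inE => <-; apply/existsP/imsetP => [[k /eqP <-]|[k _ ->]]; first by exists k.
by exists k.
Qed.

Lemma good_slot_unshared u j : good_slot u -> engaged Phi x j u -> unshared Phi x j u.
Proof.
move=> /andP[/injectiveP inj _] /existsP[k /eqP hk]; apply/cards1P; exists k.
by apply/setP => k'; rewrite !inE -hk; apply/eqP/eqP => [/inj|->].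
Qed.

Definition bad_slots t : R := \sum_(u < t) (~~ good_slot u.+1)%:R.

Definition mean_income u : R := \sum_(j | engaged Phi x j u) mu j.

Let top_income := \sum_(j | top_arm j) mu j.

Lemma mean_income_le t : \sum_(u < t) mean_income u.+1 <= t%:R * top_income.
Proof.
rewrite mulr_natl -[t in leRHS]card_ord -sumr_const; apply: ler_sum => u _.
rewrite /mean_income (eq_bigl [in [set j | engaged Phi x j u.+1]%SET]).
  by apply: sum_le_top; apply: card_engaged_le.
by move=> j; rewrite !inE.
Qed.

Lemma mean_income_ge t :
  t%:R * top_income - top_income * bad_slots t <= \sum_(u < t) mean_income u.+1.
Proof.
rewrite mulr_natl -[t in X in X - _]card_ord -sumr_const /bad_slots mulr_sumr -sumrB.
apply: ler_sum => u _; case: (boolP (good_slot u.+1)) => h /=.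
  rewrite mulr0 subr0 le_eqVlt; apply/orP; left; apply/eqP; apply: eq_bigl => j.
  by rewrite good_slot_engaged.
by rewrite mulr1 subrr sumr_ge0.
Qed.

Lemma sum_play_times j t (F : nat -> R) :
  \sum_(u <- play_times Phi x j t) F u = \sum_(u < t | engaged Phi x j u.+1) F u.+1.
Proof.
by rewrite /play_times big_filter (_ : iota 1 t = index_iota 1 t.+1)
  ?big_add1 ?big_mkord// /index_iota subn1.
Qed.

Variable C : R.
Hypothesis hx : forall j u, 0 <= x j u <= C.

Lemma total_reward_le c t :
  total_reward c Phi x t <= \sum_j \sum_(u < t | engaged Phi x j u.+1) x j u.+1.
Proof.
case: c => /=; apply: ler_sum => j _; rewrite sum_play_times //.
apply: ler_sum => u _; rewrite ler_piMr//; first by case/andP: (hx j u.+1).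
by case: (unshared Phi x j u.+1).
Qed.

(** Conflicts remove reward in bad slots only, at most [C] per arm and slot. *)
Lemma total_reward_ge c t :
  \sum_j \sum_(u < t | engaged Phi x j u.+1) x j u.+1 - N%:R * C * bad_slots t
  <= total_reward c Phi x t.
Proof.
have C0 (j : 'I_N) : 0 <= C by have /andP[] := hx j 0; apply: le_trans.
have N0 : (0 < N)%N by apply: leq_ltn_trans hMN.
have {}C0 := C0 (Ordinal N0).
have B0 : 0 <= bad_slots t by apply: sumr_ge0 => u _; rewrite ler0n.
rewrite lerBlDr; case: c => /=.
  under [in leRHS]eq_bigr do rewrite sum_play_times.
  by rewrite lerDl !mulr_ge0.
rewrite -mulrA mulr_natl -[N in _ *+ N]card_ord -sumr_const -big_split /=.
apply: ler_sum => j _; rewrite sum_play_times mulr_sumr.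
rewrite big_mkcond [in leRHS]big_mkcond -big_split /=.
apply: ler_sum => u _; have /andP[x0 xC] := hx j u.+1.
case: (boolP (good_slot u.+1)) => h /=; last first.
  rewrite mulr1; case: ifP => _; last by lra.
  by case: (unshared Phi x j u.+1); rewrite ?mulr1 ?mulr0; lra.
rewrite mulr0 addr0; case: ifP => // he.
by rewrite good_slot_unshared// mulr1.
Qed.

End TopArms.

(** * The arms chosen by RUCB along a path of states *)

Section RucbArms.
Variables (R : realType) (M N : nat) (hMN : (M < N)%N) (L D : nat -> R).
Variables (best : 'I_M -> history R N -> 'I_M -> 'I_N) (Phi : policy R M N).
Hypothesis hPhi : forall k h, Phi k h = rucb hMN D best k h.
Variable x : 'I_N -> nat -> R.

Local Notation ep := (epoch_after M N D).

Lemma rucb_arm k n : arm_of Phi x k n.+1 =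
  if ep_exploit (ep n) then
    best k (local_history Phi x k (ep_start (ep n)).-1)
      (cyclic_shift (leq_ltn_trans (leq0n k) (ltn_ord k)) (subepoch_index M N D n) k)
  else exploration_arm D hMN k n.
Proof.
have hM : (0 < M)%N by apply: leq_ltn_trans (ltn_ord k).
rewrite /arm_of hPhi /rucb size_local_history /=; case: ifP => _ //.
by rewrite take_local_history// -ltnS prednK; case: (epoch_afterP D hM hMN n).
Qed.

Lemma rucb_arm_eq k n : block_bound M N D n.+1 = block_bound M N D n ->
  arm_of Phi x k n.+2 = arm_of Phi x k n.+1.
Proof.
have hM : (0 < M)%N by apply: leq_ltn_trans (ltn_ord k).
move=> /(block_bound_eq hM hMN)[he hi].
by rewrite !rucb_arm /exploration_arm hi he.
Qed.

(** A player changes its arm only when [block_bound] increases, so [block_bound] can serve as the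
    run counter of [telescoping_runs_ge]. *)
Lemma rucb_observed_ge (a : nat -> R) (G : R) k i n :
  (forall u, 0 <= a u <= G) ->
  - (G * (block_bound M N D n)%:R) <=
  \sum_(u < n | arm_of Phi x k u.+1 == i) (a u.+1 - a u).
Proof.
have hM : (0 < M)%N by apply: leq_ltn_trans (ltn_ord k).
move=> ha; apply: (telescoping_runs_ge (sel := fun u => arm_of Phi x k u.+1 == i)) => //.
  by move=> u; apply: block_bound_mono.
move=> u h1 h2; rewrite ltn_neqAle block_bound_mono// andbT eq_sym.
by apply: contraNneq h1 => h; rewrite -(rucb_arm_eq k h).
Qed.

Lemma rucb_play_count_ge k i n :
  (4 ^ ep_nO (ep n) <= 3 * play_count (local_history Phi x k n) i + 1)%N.
Proof.
have hM : (0 < M)%N by apply: leq_ltn_trans (ltn_ord k).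
apply: leq_trans (exploration_plays_ge D hM hMN k i n) _.
rewrite leq_add2r leq_mul2l /= play_count_local_history; apply: leq_sum => u _.
by rewrite rucb_arm; case: (ep_exploit _).
Qed.

Lemma cyclic_shift_inj m (k k' : 'I_M) (hk hk' : (0 < M)%N) : (m < M)%N ->
  cyclic_shift hk m k = cyclic_shift hk' m k' -> k = k'.
Proof.
move=> mM E; apply: val_inj => /=; set i := cyclic_shift hk m k in E.
have /eqP h : m == ((i + k) %% M)%N by rewrite -(cyclic_shift_eq hk).
have /eqP h' : m == ((i + k') %% M)%N by rewrite -(cyclic_shift_eq hk') ?E.
have /eqP : (i + k == i + k' %[mod M])%N by rewrite -h -h'.
by move=> /eqP; rewrite eqn_modDl !modn_small// => /eqP.
Qed.

End RucbArms.

(** * Elementary bounds on limits, logarithms and harmonic sums *)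

Lemma positive_lower_bound (R : realType) (I : finType) (F : I -> R) :
  (forall i, 0 < F i) -> exists2 c, 0 < c & forall i, c <= F i.
Proof.
move=> F0; exists (\big[Order.min/1]_i F i).
  by apply/bigmin_gtP; split.
by move=> i; apply: bigmin_le_cond.
Qed.

Lemma eventually_ge (R : realType) (u : nat -> R) (A : R) :
  u t @[t --> \oo] --> +oo -> exists t0, forall t, (t0 <= t)%N -> A <= u t.
Proof. by move=> /cvgryPge/(_ A)[t0 _ h]; exists t0 => t; apply: h. Qed.

Lemma ln_nat_ge0 (R : realType) n : 0 <= ln n%:R :> R.
Proof. by case: n => [|n]; [rewrite ln0|apply: ln_ge0; rewrite ler1n]. Qed.

Lemma ler_ln_nat (R : realType) m n : (m <= n)%N -> ln m%:R <= ln n%:R :> R.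
Proof.
case: m => [|m] mn; first by rewrite [ln 0%:R]ln0// ln_nat_ge0.
by rewrite ler_ln ?posrE ?ltr0n// ?ler_nat//; apply: leq_trans mn.
Qed.

Lemma ln_nat_cvg (R : realType) (A : R) :
  exists t0, forall t, (t0 <= t)%N -> A <= ln t%:R.
Proof.
exists (Num.trunc (expR A)).+1 => t ht.
have e0 := expR_gt0 A.
have h : expR A <= t%:R.
  by apply: le_trans (ltW (truncnS_gt _)) _; rewrite ler_nat.
by rewrite -[A]expRK ler_ln ?posrE// (lt_le_trans e0).
Qed.

Lemma harmonic_sum_le (R : realType) t :
  \sum_(u < t.+1) (u.+1)%:R^-1 <= 1 + ln t.+1%:R :> R.
Proof.
elim: t => [|t IHt]; first by rewrite big_ord_recr big_ord0 /= add0r invr1 ln1 addr0.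
rewrite big_ord_recr /=; apply: le_trans (lerD IHt (lexx _)) _.
rewrite -addrA lerD2l.
have t1 : 0 < t.+1%:R :> R by [].
have t2 : 0 < t.+2%:R :> R by [].
have : ln (t.+1%:R / t.+2%:R) <= - t.+2%:R^-1 :> R.
  have := @le_ln1Dx R (- t.+2%:R^-1).
  rewrite ltrN2 invf_lt1// ltr1n => /(_ isT).
  rewrite (_ : 1 - _ = t.+1%:R / t.+2%:R)//.
  by rewrite -[X in X - _](divff (lt0r_neq0 t2)) -[X in _ - X]div1r -mulrBl -natr1 addrK.
rewrite ln_div ?posrE// lerBlDr => h.
by rewrite -lerBrDr addrC.
Qed.

(** Turns the bounds on the powers of 4 in the schedule into logarithmic bounds on the numbers of
    epochs. *)
Lemma pow4_log_le (R : realType) a t : (0 < t)%N -> (4 ^ a <= 3 * t)%N ->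
  a%:R * ln 4 <= ln 3 + ln t%:R :> R.
Proof.
move=> t0 h; rewrite -lnM ?posrE ?ltr0n// mulr_natl -lnXn ?ltr0n//.
rewrite ler_ln ?posrE ?exprn_gt0 ?mulr_gt0 ?ltr0n//.
by rewrite -natrX -natrM ler_nat.
Qed.

(** * Reduction of the regret to the mean number of bad slots *)

Section Regret.
Variables (R : realType) (M N : nat) (hM : (0 < M)%N) (hMN : (M < N)%N).
Variables (S : 'I_N -> {fset R}) (P : forall j, S j -> S j -> R).
Variable (pi : forall j, S j -> R).
Arguments P : clear implicits.
Arguments pi : clear implicits.
Hypothesis hP : forall j, stochastic (P j).
Hypothesis hirr : forall j, irreducible_chain (P j).
Hypothesis hpi : forall j, stationary_distribution (P j) (pi j).
Hypothesis hpos : forall j (x : S j), 0 < val x.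

Local Notation mu := (fun j => stationary_mean (pi j)).

(* The sign [b] serves to obtain both tails from the same estimate. *)
Definition deviation (b : bool) j (x : S j) : R := (-1) ^+ b * (val x - mu j).
Arguments deviation : clear implicits.

(** The deviation has mean zero under [pi j], so the Poisson equation is solvable for each sign and
    arm; the sum of the finitely many bounds is a common [G]. *)
Lemma deviation_poisson : exists (g : bool -> forall j, S j -> R) (G : R),
  (forall b j x, 0 <= g b j x <= G) /\
  (forall b j x, \sum_y P j x y * g b j y = g b j x - deviation b j x).
Proof.
have H (p : bool * 'I_N) := poisson_solution (hP p.2) (@hirr p.2) (hpi p.2)
  (phi := deviation p.1 p.2).
have {}H (p : bool * 'I_N) : exists (gG : (S p.2 -> R) * R), [/\ 0 <= gG.2,
    forall x, 0 <= gG.1 x <= gG.2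
    & forall x, \sum_y P p.2 x y * gG.1 y = gG.1 x - deviation p.1 p.2 x].
  case: (H p) => [|g [G h]]; last by exists (g, G).
  have [_ pi1 _] := hpi p.2.
  transitivity ((-1) ^+ p.1 * (\sum_x val x * pi p.2 x - mu p.2 * \sum_x pi p.2 x)).
    rewrite mulr_sumr -sumrB mulr_sumr; apply: eq_bigr => x _.
    by rewrite /deviation; ring.
  by rewrite pi1 mulr1 subrr mulr0.
pose gG p := projT1 (cid (H p)).
have hgG p := projT2 (cid (H p)).
have G0 p : 0 <= (gG p).2 by case: (hgG p).
exists (fun b j => (gG (b, j)).1), (\sum_p (gG p).2); split=> b j x; last first.
  by have [_ _] := hgG (b, j); apply.
have [_ /(_ x)/andP[h1 h2] _] := hgG (b, j); apply/andP; split => //.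
apply: le_trans h2 _; rewrite (bigD1 (b, j))//= lerDl.
by apply: sumr_ge0 => p _; apply: G0.
Qed.

Lemma state_bound : exists C, forall j (x : S j), val x <= C.
Proof.
exists (\sum_(j < N) \sum_(x : S j) val x) => j x.
rewrite (bigD1 j)//= (bigD1 x)//= -addrA lerDl addr_ge0//.
  by apply: sumr_ge0 => y _; apply/ltW/hpos.
by apply: sumr_ge0 => i _; apply: sumr_ge0 => y _; apply/ltW/hpos.
Qed.

Lemma stationary_mean_ge0 j : 0 <= mu j.
Proof.
have [pi0 _ _] := hpi j.
by apply: sumr_ge0 => x _; rewrite mulr_ge0// ltW.
Qed.

Variables (sigma : 'S_N) (hmu : injective mu) (hsigma : ranks_means mu sigma).
Variables (Phi : policy R M N).
Variables (d : measure_display) (Omega : measurableType d).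
Variables (Pr : probability Omega R) (s : forall j, nat -> Omega -> S j).
Arguments s : clear implicits.
Hypothesis hs : exogenous_process P Phi Pr s.

Lemma eq_total_reward c x x' t :
  (forall j u, (0 < u <= t)%N -> x j u = x' j u) ->
  total_reward c Phi x t = total_reward c Phi x' t.
Proof.
move=> h.
have harm k (u : 'I_t) : arm_of Phi x k u.+1 = arm_of Phi x' k u.+1.
  apply: eq_arm_of => j v /andP[v0 vu]; apply: h; rewrite v0.
  by apply: leq_trans (ltn_ord u); rewrite leqW.
have heng j (u : 'I_t) : engaged Phi x j u.+1 = engaged Phi x' j u.+1.
  by apply: eq_existsb => k; rewrite harm.
have hun j (u : 'I_t) : unshared Phi x j u.+1 = unshared Phi x' j u.+1.
  by rewrite /unshared; congr (_ == _); apply: eq_card => k; rewrite !inE harm.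
have hxu j (u : 'I_t) : x j u.+1 = x' j u.+1 by apply: h; rewrite /= ltn_ord.
case: c => /=; apply: eq_bigr => j _.
  by rewrite !sum_play_times; apply: eq_big => u //; rewrite heng.
by rewrite !sum_play_times; apply: eq_big => u; rewrite ?heng// hun hxu.
Qed.

Variable y0 : joint_state S.

Local Notation mean := (path_mean Pr (joint_process s)).
Local Notation states := (path_states y0).
Local Notation top_income := (\sum_(i < N | (i < M)%N) mu (sigma i)).

(** The reward up to [t] depends on [t] slots only; paths of length [t.+1] match the horizon of
    [engaged_sum_mean]. *)
Lemma regretE c t : regret c mu sigma Phi Pr (fun j t w => val (s j t w)) t =
  t%:R * top_income - mean t.+1 (fun l => total_reward c Phi (states l) t).
Proof.
rewrite /regret; congr (_ - _).
rewrite -(expectation_trajectory Pr (measurable_joint_process hs)).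
congr (fine ('E_Pr[_])); apply/funext => w; apply: eq_total_reward => j u /andP[u0 ut].
have ut' : (u.-1 < t.+1)%N by rewrite ltnS (leq_trans (leq_pred _)).
rewrite /path_states (nth_map (Ordinal ut')) ?size_enum_ord//.
by rewrite nth_enum_ord// /joint_process fprodE prednK.
Qed.

(** The reward [W] without conflict losses has the mean of [mean_income] up to [N * G]. Each bad
    slot costs a constant, in income and through conflicts. The lower bound on the regret, required
    by the absolute value, holds since no slot has mean income above that of the top arms. *)
Lemma regret_le : exists A B, [/\ 0 <= A, 0 <= B & forall c t,
  `|regret c mu sigma Phi Pr (fun j t w => val (s j t w)) t| <=
  A + B * mean t.+1 (fun l => bad_slots sigma Phi (states l) t)].
Proof.
have [g [G [hg hgphi]]] := deviation_poisson.
have [C hC] := state_bound.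
have N0 : (0 < N)%N by apply: leq_ltn_trans hMN.
have C0 : 0 <= C by apply: le_trans (hC _ (y0 (Ordinal N0))); apply/ltW/hpos.
have G0 : 0 <= G.
  by have /andP[] := hg false _ (y0 (Ordinal N0)); apply: le_trans.
have mu0 := stationary_mean_ge0.
have top0 : 0 <= top_income by apply: sumr_ge0.
exists (N%:R * G), (top_income + N%:R * C); split; rewrite ?addr_ge0 ?mulr_ge0// => c t.
rewrite regretE.
pose W l : R := \sum_(j < N) \sum_(u < t | engaged Phi (states l) j u.+1) states l j u.+1.
have hx l j u : 0 <= states l j u <= C by rewrite hC ltW// hpos.
have WE : mean t.+1 W = mean t.+1 (fun l => \sum_(u < t) mean_income mu Phi (states l) u.+1)
    + \sum_j mean t.+1 (engaged_sum Phi y0 (deviation false) j t).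
  rewrite -path_mean_sum -path_meanD; apply: eq_path_mean => l _.
  rewrite /W /mean_income [X in _ = X + _](exchange_big_dep xpredT)//= -big_split.
  apply: eq_bigr => j _ /=.
  rewrite /engaged_sum -big_split; apply: eq_bigr => u _ /=.
  by rewrite /deviation expr0 mul1r addrC subrK.
have hE : `|\sum_j mean t.+1 (engaged_sum Phi y0 (deviation false) j t)| <= N%:R * G.
  apply: le_trans (ler_norm_sum _ _ _) _.
  rewrite mulr_natl -[N in _ *+ N]card_ord -sumr_const; apply: ler_sum => j _.
  exact: (engaged_sum_mean hs hP y0 (hg false) (hgphi false)).
have h1 : mean t.+1 (fun l => total_reward c Phi (states l) t) <= mean t.+1 W.
  by apply: ler_path_mean => l _; apply: total_reward_le (hx l) _ _.
have h2 : mean t.+1 W - N%:R * C * mean t.+1 (fun l => bad_slots sigma Phi (states l) t)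
    <= mean t.+1 (fun l => total_reward c Phi (states l) t).
  rewrite -path_meanZ -path_meanB; apply: ler_path_mean => l _.
  exact: (total_reward_ge hMN sigma Phi (hx l)).
have topE := sum_top_arm M mu sigma.
have cst a : mean t.+1 (fun=> a) = a by apply: path_mean_cst (measurable_joint_process hs) _ _.
have h3 : mean t.+1 (fun l => \sum_(u < t) mean_income mu Phi (states l) u.+1) <=
    t%:R * top_income.
  rewrite -[leRHS]cst; apply: ler_path_mean => l _; rewrite topE.
  exact: (mean_income_le hMN hsigma mu0).
have h4 : t%:R * top_income - top_income *
    mean t.+1 (fun l => bad_slots sigma Phi (states l) t) <=
    mean t.+1 (fun l => \sum_(u < t) mean_income mu Phi (states l) u.+1).
  rewrite -[X in X - _]cst -path_meanZ -path_meanB; apply: ler_path_mean => l _.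
  by rewrite topE; apply: (mean_income_ge hMN sigma mu0).
have hB : 0 <= mean t.+1 (fun l => bad_slots sigma Phi (states l) t).
  by rewrite -[leLHS]cst; apply: ler_path_mean => l _; apply: sumr_ge0 => u _; rewrite ler0n.
have h5 : 0 <= top_income * mean t.+1 (fun l => bad_slots sigma Phi (states l) t).
  by rewrite mulr_ge0.
have h6 : 0 <= N%:R * C * mean t.+1 (fun l => bad_slots sigma Phi (states l) t).
  by rewrite !mulr_ge0.
move: h1 h2 h3 h4 h5 h6 hE; rewrite WE.
move: (mean t.+1 (fun l => bad_slots sigma Phi (states l) t)) top_income.
move: (mean t.+1 (fun l => total_reward c Phi (states l) t)).
move: (mean t.+1 (fun l => \sum_(u < t) mean_income mu Phi (states l) u.+1)).
move: (\sum_j mean t.+1 (engaged_sum Phi y0 (deviation false) j t)).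
move: (N%:R) (t%:R) => n' t' e i r b top.
by rewrite !ler_norml => *; apply/andP; split; lra.
Qed.

Variables (L D : nat -> R) (best : 'I_M -> history R N -> 'I_M -> 'I_N).
Hypothesis hbest : forall k h, top_arms (ucb_index L h) (best k h).
Hypothesis hPhi : forall k h, Phi k h = rucb hMN D best k h.

Local Notation ep := (epoch_after M N D).

(** * Probability of a bad slot in an exploitation epoch *)

Section Concentration.
Variable eps : R.
Hypothesis eps0 : 0 < eps.
Hypothesis hgap : forall i j, mu i < mu j -> mu i + 6 * eps <= mu j.

(** The two signs put the sample mean within [2 * eps] of [mu i], and at least [X] plays keep the
    padding below [eps]. Two errors below [3 * eps] cannot bridge the gap [6 * eps]. *)
Lemma ucb_index_close x k i n X :
  0 < X -> X <= (play_count (local_history Phi x k n) i)%:R ->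
  (forall b : bool, \sum_(u < n | arm_of Phi x k u.+1 == i)
     (-1) ^+ b * (x i u.+1 - mu i) <
     2 * eps * (play_count (local_history Phi x k n) i)%:R) ->
  0 <= L n.+1 * ln n.+1%:R <= eps ^+ 2 * X ->
  `|ucb_index L (local_history Phi x k n) i - mu i| < 3 * eps.
Proof.
rewrite /ucb_index /sample_mean size_local_history sum_local_history.
set T := (play_count _ _)%:R; set Y := \sum_(u < n | _) x i u.+1.
move=> X0 XT hdev /andP[hl0 hl].
have T0 : 0 < T by apply: lt_le_trans XT.
have hsum b : \sum_(u < n | arm_of Phi x k u.+1 == i) (-1) ^+ b * (x i u.+1 - mu i) =
    (-1) ^+ b * (Y - mu i * T).
  rewrite -mulr_sumr; congr (_ * _); rewrite sumrB; congr (_ - _).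
  rewrite sumr_const mulr_natr play_count_local_history; congr (_ *+ _).
  by rewrite -sum1_card big_mkcond.
have hY : `|Y / T - mu i| < 2 * eps.
  have := hdev true; have := hdev false; rewrite !hsum expr0 expr1 mul1r mulN1r => d1 d2.
  have -> : Y / T - mu i = (Y - mu i * T) / T by rewrite mulrBl mulfK// gt_eqF.
  rewrite normrM normfV (gtr0_norm T0) ltr_pdivrMr// ltr_norml.
  by apply/andP; split; lra.
have hq : 0 <= Num.sqrt (L n.+1 * ln n.+1%:R / T) <= eps.
  have E : Num.sqrt (eps ^+ 2) = eps by rewrite sqrtr_sqr gtr0_norm.
  rewrite sqrtr_ge0 /= -[leRHS]E ler_wsqrtr// ler_pdivrMr//.
  by apply: le_trans hl _; rewrite ler_pM2l// exprn_gt0.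
move: hY hq; rewrite !ltr_norml => /andP[h1 h2] /andP[h3 h4].
by apply/andP; split; lra.
Qed.

Lemma close_index_best k h :
  (forall i, `|ucb_index L h i - mu i| < 3 * eps) ->
  forall m, best k h m = sigma (widen_ord (ltnW hMN) m).
Proof.
move=> hc; apply: (top_arms_sigma hMN hmu hsigma _ (hbest k h)) => i j hij.
have := hgap hij; have := hc i; have := hc j.
rewrite !ltr_norml => /andP[h1 h2] /andP[h3 h4]; lra.
Qed.

Lemma best_good_slot x n : ep_exploit (ep n) ->
  (forall k m, best k (local_history Phi x k (ep_start (ep n)).-1) m =
     sigma (widen_ord (ltnW hMN) m)) ->
  good_slot sigma Phi x n.+1.
Proof.
move=> hx hb; apply/andP; split.
  apply/injectiveP => k k'; rewrite !(rucb_arm hPhi) hx !hb => /perm_inj/(congr1 val)/= E.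
  apply: (@cyclic_shift_inj _ (subepoch_index M N D n) _ _ hM hM); last exact: val_inj.
  by have := subepoch_index_lt D hM hMN n; rewrite hx.
by apply/forallP => k; rewrite (rucb_arm hPhi) hx hb /top_arm permK /= ltn_mod.
Qed.

Variables (g : bool -> forall j, S j -> R) (G : R).
Arguments g : clear implicits.
Hypothesis hg : forall b j x, 0 <= g b j x <= G.

Local Notation exponent b i k :=
  (observed_exponent Phi y0 (deviation b) (g b) eps i k).

(** If all indexes at the start of the epoch are close, the slot is good; so some deviation sum
    reaches [2 * eps * T]. The exponent subtracts [eps * T] from it and loses at most [G] per run;
    finally [T >= X]. *)
Lemma bad_slot_exponent n l : ep_exploit (ep n) ->
  0 <= L (ep_start (ep n)) * ln (ep_start (ep n))%:R <=
    eps ^+ 2 * ((4 ^+ ep_nO (ep n) - 1) / 3) ->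
  0 < (4 ^+ ep_nO (ep n) - 1) / 3 :> R ->
  ~~ good_slot sigma Phi (states l) n.+1 ->
  exists k i b, eps * ((4 ^+ ep_nO (ep n) - 1) / 3)
    - G * (N * (ep_nO (ep n) + ep_nI (ep n))).+1%:R
    <= exponent b i k (ep_start (ep n)).-1 l.
Proof.
move=> hx; set tau := ep_start (ep n); set X := (_ / 3); set K := (_.+1).
move=> hL X0 hbad; pose n0 := tau.-1.
have tau0 : (0 < tau)%N by case: (epoch_afterP D hM hMN n).
have ntau : n0.+1 = tau by rewrite prednK.
have epn : ep n0 = ep n by apply: epoch_after_start.
apply: contrapT => hno; move/negP: hbad; apply.
apply: best_good_slot => // k m; apply: close_index_best => i.
have hT : X <= (play_count (local_history Phi (states l) k n0) i)%:R.
  have := rucb_play_count_ge hPhi (states l) k i n0.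
  rewrite epn -(ler_nat R) natrD natrM natrX /X; move: (play_count _ _) (4 ^+ _) => T p.
  by rewrite ler_pdivrMr//; lra.
apply: (ucb_index_close X0 hT); last by rewrite ntau.
move=> b; set T := (play_count _ _)%:R in hT *.
rewrite ltNge; apply/negP => hdev; apply: hno; exists k, i, b.
have hrun := rucb_observed_ge hPhi (states l) k i n0 (fun u => hg b (nth y0 l u i)).
rewrite block_bound_start ?epn // -/K in hrun.
rewrite /observed_exponent big_split /= sumrB sumr_const.
have -> : eps *+ #|[pred u : 'I_n0 | arm_of Phi (states l) k u.+1 == i]| = eps * T.
  rewrite mulr_natr /T play_count_local_history; congr (_ *+ _).
  by rewrite -sum1_card big_mkcond.
have {}hT : eps * X <= eps * T by rewrite ler_pM2l.
move: hdev hrun; rewrite -mulrA /deviation /path_states /=.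
move: (eps * T) (eps * X) hT (G * _).
by move: (\sum_(u < n0 | _) _) (\sum_(u < n0 | _) _) => *; lra.
Qed.

Variable lam : bool -> 'I_N -> R.
Hypothesis lam0 : forall b i, 0 < lam b i.
Hypothesis htilt : forall b i x, \sum_y P i x y *
  expR (lam b i * (deviation b i x - eps + (g b i y - g b i x))) <= 1.

Lemma exponent_take b i k n l : exponent b i k n (take n.+1 l) = exponent b i k n l.
Proof.
have harm (u : 'I_n) : arm_of Phi (states (take n.+1 l)) k u.+1 = arm_of Phi (states l) k u.+1.
  apply: eq_arm_of => j v /andP[v0 vu]; rewrite /path_states nth_take//.
  by apply: leq_ltn_trans (leq_pred _) _; apply: leq_trans vu _; rewrite ltnS ltnW.
rewrite /observed_exponent; apply: eq_big => u; first by rewrite harm.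
by rewrite !nth_take ?ltnS// ltnW.
Qed.

Lemma exponent_mean_le b i k n t : (n <= t)%N ->
  mean t.+1 (fun l => expR (lam b i * exponent b i k n l)) <= 1.
Proof.
move=> nt; have N0 : (0 < N)%N by apply: leq_ltn_trans hMN.
rewrite (eq_path_mean _ _
  (G := fun l => expR (lam b i * exponent b i k n (take n.+1 l)))); last first.
  by move=> l _; rewrite exponent_take.
rewrite (path_mean_widen (path_mass_step hs y0) _
  (fun l => expR (lam b i * exponent b i k n l))) ?ltnS//.
  exact: (observed_supermartingale hs hP).
by move=> l _; apply: joint_kernel_sum1.
Qed.

(** Markov inequality for the exponential supermartingale, with a union bound over the [2 * M * N]
    choices of sign, player and arm; each contributes at most [1 / tau]. *)
Lemma bad_slot_mean n t : (n < t)%N -> ep_exploit (ep n) ->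
  0 <= L (ep_start (ep n)) * ln (ep_start (ep n))%:R <=
    eps ^+ 2 * ((4 ^+ ep_nO (ep n) - 1) / 3) ->
  0 < (4 ^+ ep_nO (ep n) - 1) / 3 :> R ->
  (forall b i, ln (ep_start (ep n))%:R <=
    lam b i * (eps * ((4 ^+ ep_nO (ep n) - 1) / 3)
      - G * (N * (ep_nO (ep n) + ep_nI (ep n))).+1%:R)) ->
  mean t.+1 (fun l => (~~ good_slot sigma Phi (states l) n.+1)%:R) <=
    (2 * M * N)%:R / (ep_start (ep n))%:R.
Proof.
move=> nt hx hL X0 hlam.
have [tau0 taun _] := epoch_afterP D hM hMN n.
set tau := ep_start (ep n) in hL hlam tau0 taun *.
set A := (_ - _) in hlam.
pose E (p : 'I_M * 'I_N * bool) l : R :=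
  expR (- ln tau%:R) * expR (lam p.2 p.1.2 * exponent p.2 p.1.2 p.1.1 tau.-1 l).
apply: (@le_trans _ _ (mean t.+1 (fun l => \sum_p E p l))).
  apply: ler_path_mean => l _.
  have E0 p : 0 <= E p l by rewrite mulr_ge0// expR_ge0.
  case: (boolP (good_slot sigma Phi (states l) n.+1)) => [_|hbad] /=.
    exact: sumr_ge0.
  have [k [i [b hA]]] := bad_slot_exponent hx hL X0 hbad.
  rewrite (bigD1 (k, i, b))//= -[1]addr0 lerD//; last exact: sumr_ge0.
  rewrite /E -expRD -[leLHS]expR0 ler_expR addrC subr_ge0 /=.
  by apply: le_trans (hlam b i) _; rewrite ler_pM2l.
rewrite path_mean_sum.
apply: (@le_trans _ _ (\sum_(p : 'I_M * 'I_N * bool) tau%:R^-1)).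
  apply: ler_sum => -[[k i] b] _; rewrite path_meanZ.
  rewrite expRN lnK ?posrE ?ltr0n// ler_piMr ?invr_ge0//.
  by apply: exponent_mean_le; rewrite -ltnS prednK//; apply: leq_trans taun (leqW nt).
rewrite sumr_const !card_prod !card_ord card_bool -[_ *+ _]mulr_natl.
by rewrite mulnC mulnA.
Qed.

End Concentration.

(** * Choice of constants, and the mean number of bad slots *)

Hypotheses (hL0 : forall t, 0 < L t) (hD0 : forall t, 0 < D t).
Hypothesis hL : L t @[t --> \oo] --> +oo.
Hypothesis hDL : D t / L t @[t --> \oo] --> +oo.

Lemma exploration_rate_cvg (A : R) : 0 <= A ->
  exists t0, forall t, (t0 <= t)%N -> A <= D t.
Proof.
move=> A0; have [t1 h1] := eventually_ge 1 hL; have [t2 h2] := eventually_ge A hDL.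
exists (maxn t1 t2) => t; rewrite geq_max => /andP[/h1 l1 /h2].
rewrite ler_pdivlMr//; apply: le_trans.
by rewrite ler_peMr.
Qed.

Lemma bad_exploitation_slot_mean : exists t0, forall n t,
  (n < t)%N -> ep_exploit (ep n) -> (t0 <= ep_start (ep n))%N ->
  mean t.+1 (fun l => (~~ good_slot sigma Phi (states l) n.+1)%:R) <=
    (2 * M * N)%:R / (ep_start (ep n))%:R.
Proof.
have [g [G [hg hgphi]]] := deviation_poisson.
have N0 : (0 < N)%N by apply: leq_ltn_trans hMN.
have G0 : 0 <= G.
  by have /andP[] := hg false _ (y0 (Ordinal N0)); apply: le_trans.
(* [c0] is at most every positive difference of means; the remaining pairs get the dummy value 1. *)
have [c0 c00 hc0] : exists2 c, 0 < c & forall p : 'I_N * 'I_N,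
    c <= if mu p.1 < mu p.2 then mu p.2 - mu p.1 else 1.
  apply: positive_lower_bound => p.
  by case: (ltP (mu p.1) (mu p.2)) => h; [rewrite subr_gt0|exact: ltr01].
pose eps := c0 / 6.
have eps0 : 0 < eps by rewrite divr_gt0.
have hgap i j : mu i < mu j -> mu i + 6 * eps <= mu j.
  by move=> ij; have := hc0 (i, j); rewrite /= ij /eps => h; lra.
have H (p : bool * 'I_N) : exists lam, 0 < lam /\ forall x, \sum_y P p.2 x y *
  expR (lam * (deviation p.1 p.2 x - eps + (g p.1 p.2 y - g p.1 p.2 x))) <= 1.
  have [lam l1 l2] := exponential_tilt (hP p.2) eps0 (hg p.1 p.2) (hgphi p.1 p.2).
  by exists lam.
pose lam b i := projT1 (cid (H (b, i))).
have hlam b i := projT2 (cid (H (b, i))).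
have lam0 b i : 0 < lam b i by have [] := hlam b i.
have [c1 c10 hc1] := positive_lower_bound (fun p : bool * 'I_N => lam0 p.1 p.2).
have l4 : 0 < ln 4 :> R by rewrite ln_gt0// ltr1n.
(* [B * ln tau] bounds the number of runs: once [ln tau >= 1 + ln 3], there are at most
   [2 * ln tau / ln 4] epochs of each type. *)
pose B := 4 * N%:R / ln 4 + 1 : R.
have B0 : 0 <= B by rewrite addr_ge0// divr_ge0 ?mulr_ge0// ltW.
(* Beyond [t1], [L <= eps^2 * D] keeps the padding small; beyond [t2], [D] is so large that
   [eps * X - G * K] is at least [ln tau / c1]. *)
have [t1 h1] := eventually_ge (eps ^+ 2)^-1 hDL.
have A0 : 0 <= (c1^-1 + G * B) / eps.
  apply: divr_ge0; last exact: ltW.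
  by apply: addr_ge0; [rewrite invr_ge0 ltW|apply: mulr_ge0].
have [t2 h2] := exploration_rate_cvg A0.
have [t3 h3] := @ln_nat_cvg R (1 + ln 3).
exists (maxn t1 (maxn t2 t3)) => n t nt hx; rewrite !geq_max => /and3P[].
set tau := ep_start (ep n) => /h1 {}h1 /h2 {}h2 /h3 {}h3.
have [tau0 _ _] := epoch_afterP D hM hMN n.
have l3 : 0 <= ln 3 :> R by apply: ln_ge0; rewrite ler1n.
have l1 : 1 <= ln tau%:R :> R by lra.
have htest : D tau * ln tau%:R < (4 ^+ ep_nO (ep n) - 1) / 3 := exploitation_testP hM hMN hx.
have D0 : 0 < D tau * ln tau%:R by rewrite mulr_gt0//; lra.
set X := (_ / 3) in htest.
apply: (bad_slot_mean eps0 hgap hg lam0) => //.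
- by move=> b i x; have [_] := hlam b i; apply.
- rewrite -/tau mulr_ge0 ?(ltW (hL0 _)) ?ln_nat_ge0//=.
  apply: (@le_trans _ _ (eps ^+ 2 * (D tau * ln tau%:R))); last first.
    by rewrite ler_pM2l ?exprn_gt0// ltW.
  rewrite mulrA ler_wpM2r ?ln_nat_ge0//.
  by move: h1; rewrite ler_pdivlMr// ler_pdivrMl ?exprn_gt0.
- by apply: lt_trans htest.
- move=> b i; rewrite -/tau -/X.
  set K := (_.+1).
  have hK : G * K%:R <= G * B * ln tau%:R.
    rewrite -mulrA; apply: ler_wpM2l => //.
    have nO := pow4_log_le R tau0 (exploration_pow_le D hM hMN n).
    have nI := pow4_log_le R tau0 (exploitation_pow_le D hM hMN n).
    have hs2 : (ep_nO (ep n) + ep_nI (ep n))%:R <= 4 * ln tau%:R / ln 4 :> R.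
      by rewrite ler_pdivlMr// natrD mulrDl; lra.
    rewrite /K -natr1 natrM /B mulrDl mul1r lerD//.
    apply: le_trans (ler_wpM2l _ hs2) _ => //.
    by rewrite le_eqVlt; apply/orP; left; apply/eqP; ring.
  have hX : (c1^-1 + G * B) * ln tau%:R <= eps * X.
    apply: (@le_trans _ _ (eps * (D tau * ln tau%:R))); last first.
      by rewrite ler_pM2l// ltW.
    rewrite mulrA ler_wpM2r ?ln_nat_ge0//.
    by rewrite [eps * _]mulrC -ler_pdivrMr.
  have hd : c1^-1 * ln tau%:R <= eps * X - G * K%:R.
    by move: hX hK; rewrite mulrDl; lra.
  have hd0 : 0 <= eps * X - G * K%:R.
    by apply: le_trans hd; rewrite mulr_ge0 ?ln_nat_ge0 ?invr_ge0 ?ltW.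
  apply: (@le_trans _ _ (c1 * (eps * X - G * K%:R))).
    by rewrite -ler_pdivrMl.
  by apply: ler_wpM2r => //; apply: (hc1 (b, i)).
Qed.

Lemma sum_ltn_le n K : (\sum_(u < n) (u < K)%N <= K)%N.
Proof.
suff -> : (\sum_(u < n) (u < K)%N = minn n K)%N by apply: geq_minr.
by elim: n => [|n IHn]; rewrite ?big_ord0 ?min0n// big_ord_recr /= IHn; case: ltnP; lia.
Qed.

(** Exploration slots are counted in full. Exploitation epochs starting before [t0] lie in the first
    [c * t0] slots. In later ones a slot is bad with probability at most [B] over its number, which
    gives a harmonic sum. *)
Lemma bad_slots_mean_le : exists A B, [/\ 0 <= A, 0 <= B & forall t,
  mean t.+2 (fun l => bad_slots sigma Phi (states l) t.+1) <=
  (exploration_count M N D t.+1)%:R + A + B * ln t.+1%:R].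
Proof.
have [t0 ht0] := bad_exploitation_slot_mean.
pose c := (4 + 2 * M)%N.
pose B : R := (2 * M * N * c)%:R.
exists ((c * t0)%:R + B), B; split; rewrite ?addr_ge0 /B// => t.
have slot (u : 'I_t.+1) :
    mean t.+2 (fun l => (~~ good_slot sigma Phi (states l) u.+1)%:R) <=
    (~~ ep_exploit (ep u))%:R + (u < c * t0)%N%:R + B * (u.+1)%:R^-1.
  have B0 : 0 <= B * (u.+1)%:R^-1 by rewrite mulr_ge0 ?invr_ge0.
  have le1 : mean t.+2 (fun l => (~~ good_slot sigma Phi (states l) u.+1)%:R) <= 1.
    rewrite -[leRHS](path_mean_cst Pr (measurable_joint_process hs) t.+2).
    by apply: ler_path_mean => l _; rewrite lern1 leq_b1.
  case: (boolP (ep_exploit (ep u))) => hx /=; last first.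
    by apply: le_trans le1 _; rewrite -addrA lerDl addr_ge0.
  have hu := exploitation_slot_le hM hMN hx; rewrite -/c in hu.
  rewrite add0r; case: (leqP t0 (ep_start (ep u))) => [h|h].
    apply: le_trans (ht0 _ _ (ltn_ord u) hx h) _; apply: (@le_trans _ _ (B * u.+1%:R^-1)).
      have [s0 _ _] := epoch_afterP D hM hMN u.
      rewrite /B [in leRHS]natrM -mulrA ler_wpM2l//.
      rewrite ler_pdivlMr ?ltr0n// ler_pdivrMl ?ltr0n// -natrM ler_nat.
      by rewrite mulnC.
    by rewrite lerDr.
  rewrite (leq_trans hu)/=; first by apply: le_trans le1 _; rewrite lerDl.
  by rewrite leq_mul2l (ltnW h) orbT.
rewrite path_mean_sum; apply: le_trans (ler_sum _ (fun u _ => slot u)) _.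
rewrite !big_split /= -mulr_sumr -!natr_sum -/(exploration_count M N D t.+1).
rewrite -!addrA lerD2l; apply: lerD; first by rewrite ler_nat sum_ltn_le.
rewrite -[X in _ <= X + _]mulr1 -mulrDr ler_wpM2l//.
exact: harmonic_sum_le.
Qed.

End Regret.

(** * From the count of exploration slots to the rate of the regret *)

Lemma littleo_of_exploration_count (R : realType) (N : nat)
    (f D r count : nat -> R) (A B : R) :
  (forall m n, (m <= n)%N -> f m <= f n) ->
  f t @[t --> \oo] --> +oo ->
  f t / D t @[t --> \oo] --> +oo ->
  (forall t, 0 < D t) ->
  (forall (b : nat -> R) t, (forall t, 0 <= b t) ->
     (forall t u, (t <= u)%N -> b t <= b u) ->
     (forall t, (0 < t)%N -> D t * ln t%:R <= b t) ->
     count t.+1 <= N%:R * (4 * b t.+1 + 1)) ->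
  0 <= A -> 0 <= B ->
  (forall t, `|r t.+1| <= A + B * (count t.+1 + ln t.+1%:R)) ->
  r =o_\oo (fun t => f t * ln t%:R).
Proof.
move=> hf hfoo hfD D0 hcount A0 B0 hr.
apply/eqoP => e e0.
(* [c] exceeds the factor with which the bound on [count] enters, and [c * e1 = e / 2]: half of [e]
   pays for the part proportional to [f t * ln t]. *)
pose c : R := B * N%:R * 4 + 1.
have c0 : 0 < c by rewrite ltr_wpDl// !mulr_ge0.
pose e1 : R := e / (2 * c).
have e10 : 0 < e1 by rewrite divr_gt0// mulr_gt0.
have [t1 h1] := eventually_ge e1^-1 hfD.
pose K : R := \sum_(t < t1) D t * ln t%:R.
have K0 : 0 <= K by apply: sumr_ge0 => t _; rewrite mulr_ge0 ?ln_nat_ge0// ltW.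
(* [K] majorizes [D t * ln t] before [t1], and afterwards [D t <= e1 * f t]; the maximum keeps [b]
   nonnegative and monotone while [f] is negative. *)
pose b t : R := K + e1 * (Num.max (f t) 0 * ln t%:R).
have fp0 t : 0 <= Num.max (f t) 0 by rewrite le_max lexx orbT.
have b0 t : 0 <= b t by rewrite addr_ge0// mulr_ge0 ?(ltW e10)// mulr_ge0// ln_nat_ge0.
have bmono t u : (t <= u)%N -> b t <= b u.
  move=> tu; rewrite lerD2l ler_pM2l//; apply: ler_pM => //; rewrite ?ln_nat_ge0//.
    by rewrite ge_max !le_max hf// lexx orbT.
  exact: ler_ln_nat.
have Db t : (0 < t)%N -> D t * ln t%:R <= b t.
  move=> _; case: (ltnP t t1) => ht.
    apply: (@le_trans _ _ K); last by rewrite lerDl mulr_ge0 ?(ltW e10)// mulr_ge0// ln_nat_ge0.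
    rewrite /K (bigD1 (Ordinal ht))//= lerDl.
    by apply: sumr_ge0 => u _; rewrite mulr_ge0 ?ln_nat_ge0// ltW.
  apply: (@le_trans _ _ (e1 * (Num.max (f t) 0 * ln t%:R))); last by rewrite lerDr.
  rewrite mulrA ler_wpM2r ?ln_nat_ge0//.
  have := h1 _ ht; rewrite ler_pdivlMr// ler_pdivrMl// => /le_trans; apply.
  by rewrite ler_pM2l// le_max lexx.
(* [C] collects the other terms; once [ln t >= 1] and [f t >= 2 * C / e], they fit into the second
   half of [e]. *)
pose C : R := A + B * (N%:R * (4 * K + 1) + 1).
have C0 : 0 <= C by rewrite addr_ge0// mulr_ge0// addr_ge0// mulr_ge0// addr_ge0// mulr_ge0.
have [t2 h2] := eventually_ge (2 * C / e) hfoo.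
have [t3 h3] := @ln_nat_cvg R 1.
exists (maxn t2 t3).+1 => // -[//|t] /=; rewrite ltnS geq_max => /andP[ht2 ht3].
have {}h2 := h2 _ (leqW ht2); have {}h3 := h3 _ (leqW ht3).
have f0 : 0 <= f t.+1.
  by apply: le_trans h2; rewrite divr_ge0 ?mulr_ge0// ltW.
have fl0 : 0 <= f t.+1 * ln t.+1%:R by rewrite mulr_ge0 ?ln_nat_ge0.
rewrite [X in _ <= _ * X]ger0_norm//; apply: le_trans (hr t) _.
have := hcount b t b0 bmono Db; rewrite {1}/b (max_idPl f0) => hc.
have hC : 2 * C * ln t.+1%:R <= e * (f t.+1 * ln t.+1%:R).
  rewrite mulrA ler_wpM2r ?ln_nat_ge0//.
  by rewrite [e * _]mulrC -ler_pdivrMr.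
have hcl : C - B <= (C - B) * ln t.+1%:R.
  rewrite ler_peMr// /C -addrA -{2}[B]mulr1 -mulrBr addrK.
  by rewrite addr_ge0// mulr_ge0// mulr_ge0// addr_ge0// mulr_ge0.
have he1 : c * e1 * (f t.+1 * ln t.+1%:R) = e / 2 * (f t.+1 * ln t.+1%:R).
  by congr (_ * _); rewrite /e1; field; rewrite gt_eqF.
have hBc : B * count t.+1 <=
    B * (N%:R * (4 * (K + e1 * (f t.+1 * ln t.+1%:R)) + 1)) by rewrite ler_wpM2l.
have hef : 0 <= e1 * (f t.+1 * ln t.+1%:R) by rewrite mulr_ge0// ltW.
move: hC hcl he1 hBc hef; rewrite /C /c.
move: (f t.+1 * ln t.+1%:R) (ln t.+1%:R) (count t.+1) (N%:R) => F l q n'.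
by clear; lra.
Qed.

Theorem theorem2 (R : realType) (M N : nat) (hM : (0 < M)%N) (hMN : (M < N)%N)
  (S : 'I_N -> {fset R}) (P : forall j, S j -> S j -> R)
  (pi : forall j, S j -> R)
  (hP : forall j, stochastic (P j))
  (hirr : forall j, irreducible_chain (P j))
  (haper : forall j, aperiodic_chain (P j))
  (hpi : forall j, stationary_distribution (P j) (pi j))
  (hrev : forall j, reversible_chain (P j) (pi j))
  (hpos : forall j (x : S j), 0 < val x)
  (hmu : injective (fun j => stationary_mean (pi j)))
  (sigma : 'S_N)
  (hsigma : ranks_means (fun j => stationary_mean (pi j)) sigma)
  (f : nat -> R)
  (hf : forall m n, (m <= n)%N -> f m <= f n)
  (hfoo : f t @[t --> \oo] --> +oo)
  (L D : nat -> R)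
  (hL0 : forall t, 0 < L t) (hD0 : forall t, 0 < D t)
  (hL : L t @[t --> \oo] --> +oo)
  (hfD : f t / D t @[t --> \oo] --> +oo)
  (hDL : D t / L t @[t --> \oo] --> +oo)
  (Phi : policy R M N) (hPhi : rucb_policy hMN L D Phi)
  (d : measure_display) (Omega : measurableType d) (Pr : probability Omega R)
  (s : forall j, nat -> Omega -> S j)
  (hs : exogenous_process P Phi Pr s)
  (c : conflict_model) :
  regret c (fun j => stationary_mean (pi j)) sigma Phi Pr
    (fun j t w => val (s j t w))
  =o_\oo (fun t => f t * ln t%:R).
Proof.
have [best [hbest hbestPhi]] := hPhi.
(* Each state space is nonempty because [pi j] has mass 1; this provides the default joint state
   [y0]. *)
have inh j : exists x : S j, true.
  have [_ pi1 _] := hpi j; apply/existsP; apply: contraT => /existsPn h.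
  by move: pi1; rewrite big1 => [/eqP|x]; [rewrite eq_sym oner_eq0|have := h x].
pose y0 : joint_state S := fprod_of_fun (fun j => projT1 (cid (inh j))).
have [A1 [B1 [A10 B10 hreg]]] :=
  regret_le hMN hP hirr hpi hpos hsigma hs y0.
have [A2 [B2 [A20 B20 hbad]]] := bad_slots_mean_le hM hP hirr hpi hmu hsigma hs y0
  hbest hbestPhi hL0 hD0 hL hDL.
apply: (littleo_of_exploration_count (N := N) (count := fun t => (exploration_count M N D t)%:R)
  (A := A1 + B1 * A2) (B := B1 * (1 + B2)) hf hfoo hfD hD0).
- by move=> b t b0 bmono Db; apply: exploration_count_le.
- by rewrite addr_ge0// mulr_ge0.
- by rewrite mulr_ge0// addr_ge0.
- move=> t; apply: le_trans (hreg c t.+1) _.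
  rewrite -addrA lerD2l -mulrA -mulrDr ler_wpM2l//.
  apply: le_trans (hbad t) _.
  have l0 := @ln_nat_ge0 R t.+1.
  have : 0 <= B2 * (exploration_count M N D t.+1)%:R by rewrite mulr_ge0.
  move: (ln t.+1%:R) (exploration_count _ _ _ _)%:R l0 => l q l0.
  by clear -l0; lra.
Qed.
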